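(* Let $K$ be a normal Hopf subalgebra of a semisimple Hopf algebra $H$ over $k$ and let $M$ be a finite dimensional left $K$-module. For a simple subcoalgebra $C$ of $H$ let ${}^CM:=CK\otimes_KM$, regarded as a $K$-module by left multiplication. (1) There is an isomorphism of $K$-modules $$(H\otimes_KM)\big\downarrow^H_K\ \cong\ \bigoplus_{C\in H/K}{}^CM .$$ (2) The induced module $H\otimes_KM$ is an irreducible $H$-module if and only if $M$ is an irreducible $K$-module which is not a direct summand of the conjugate module ${}^CM$ for any simple subcoalgebra $C$ of $H$ with $C\not\subset K$.
   Context: $k$ is an algebraically closed field of characteristic zero; $H$ is a semisimple (hence finite dimensional and cosemisimple) Hopf algebra over $k$. A Hopf subalgebra is normal if it is stable under the left and right adjoint actions of $H$ on itself. For subspaces $X,Y\subseteq H$, $XY$ denotes the linear span of all products $xy$. Since $K$ is normal, $KC=CK$ for every subcoalgebra $C$ of $H$, so $CK\otimes_KM$ is a left $K$-module by left multiplication. The relation $C\sim D$ iff $C\subseteq DK$ is an equivalence relation on simple subcoalgebras of $H$, with $C\sim D$ iff $CK=DK$; $H/K$ is the set of cosets $CK$, and a sum over $C\in H/K$ runs over one representative simple subcoalgebra $C$ per equivalence class. *)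

(* Defs.v *)
From HB Require Import structures.
From mathcomp Require Import all_boot all_order all_algebra all_field.

Set Implicit Arguments.
Unset Strict Implicit.
Unset Printing Implicit Defensive.

Import GRing.Theory.
Local Open Scope ring_scope.

Section Tensor.
Variables (k : fieldType) (V W : vectType k).

(* The tensor product over k, in coordinates: the (i, j) entry is the         *)
(* coefficient of e_i (x) f_j, for the library's bases e of V and f of W. The *)
(* universal property is tliftE and tensor_ext below.                         *)
Definition tensor : vectType k := 'M[k]_(\dim {:V}, \dim {:W}).

Definition tens (v : V) (w : W) : tensor :=
  \matrix_(i, j) (coord (vbasis {:V}) i v * coord (vbasis {:W}) j w).

(* The linear map v (x) w |-> b v w, meaningful for b bilinear. In Sweedler   *)
(* notation, tlift b (comul h) is \sum b h_(1) h_(2).                         *)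
Definition tlift (U : vectType k) (b : V -> W -> U) (t : tensor) : U :=
  \sum_i \sum_j t i j *: b (vbasis {:V})`_i (vbasis {:W})`_j.

Definition bilin (U : vectType k) (b : V -> W -> U) :=
  (forall w, linear (b^~ w)) /\ (forall v, linear (b v)).

Lemma tlift_linear (U : vectType k) (b : V -> W -> U) : linear (tlift b).
Proof.
move=> c s t; rewrite /tlift scaler_sumr -big_split; apply: eq_bigr => i _ /=.
rewrite scaler_sumr -big_split; apply: eq_bigr => j _ /=.
by rewrite !mxE scalerDl scalerA.
Qed.
HB.instance Definition _ (U : vectType k) (b : V -> W -> U) :=
  GRing.isLinear.Build k tensor U *:%R (tlift b) (tlift_linear b).

Lemma tlift_lin (U : vectType k) (b b' : V -> W -> U) c t :
  tlift (fun v w => c *: b v w + b' v w) t = c *: tlift b t + tlift b' t.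
Proof.
rewrite /tlift scaler_sumr -big_split; apply: eq_bigr => i _ /=.
rewrite scaler_sumr -big_split; apply: eq_bigr => j _ /=.
by rewrite scalerDr !scalerA [c * _]mulrC.
Qed.

Lemma eq_tlift (U : vectType k) (b b' : V -> W -> U) : b =2 b' -> tlift b =1 tlift b'.
Proof.
by move=> eb t; apply: eq_bigr => i _; apply: eq_bigr => j _; rewrite eb.
Qed.

Lemma bilin_sum (U : vectType k) (b : V -> W -> U) m n (a : 'I_m -> k) (c : 'I_n -> k)
    (e : 'I_m -> V) (f : 'I_n -> W) : bilin b ->
  b (\sum_i a i *: e i) (\sum_j c j *: f j)
  = \sum_i \sum_j (a i * c j) *: b (e i) (f j).
Proof.
move=> [bl br]; set w : W := (X in b _ X = _).
pose h := GRing.isLinear.Build k V U *:%R (b^~ w) (bl w).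
pose bw : {linear V -> U} := HB.pack (b^~ w) h.
rewrite -[LHS]/(bw _) linear_sum; apply: eq_bigr => i _; rewrite linearZ /= /w.
pose h' := GRing.isLinear.Build k W U *:%R (b (e i)) (br (e i)).
pose bv : {linear W -> U} := HB.pack (b (e i)) h'.
rewrite -[b _ _]/(bv _) linear_sum scaler_sumr; apply: eq_bigr => j _.
by rewrite linearZ scalerA.
Qed.

Lemma tliftE (U : vectType k) (b : V -> W -> U) v w : bilin b -> tlift b (tens v w) = b v w.
Proof.
move=> hb; rewrite [in RHS](coord_vbasis (memvf v)) [in RHS](coord_vbasis (memvf w)).
rewrite bilin_sum //; apply: eq_bigr => i _; apply: eq_bigr => j _.
by rewrite mxE.
Qed.

Lemma tens_bilin : bilin tens.
Proof.
split=> u c x y; apply/matrixP=> i j; rewrite !mxE linearP /=.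
  by rewrite mulrDl mulrA.
by rewrite mulrDr mulrCA.
Qed.

Lemma tensor_ext (U : vectType k) (f g : {linear tensor -> U}) :
  (forall v w, f (tens v w) = g (tens v w)) -> f =1 g.
Proof.
move=> fg t; rewrite [t]matrix_sum_delta !linear_sum; apply: eq_bigr => i _.
rewrite !linear_sum; apply: eq_bigr => j _; rewrite !linearZ /=; congr (_ *: _).
suff -> : delta_mx i j = tens (vbasis {:V})`_i (vbasis {:W})`_j by [].
have freeb (T : vectType k) : free (vbasis {:T}) := basis_free (vbasisP _).
apply/matrixP=> i' j'; rewrite !mxE !coord_free //.
by rewrite -natrM mulnb eq_sym [j' == j]eq_sym.
Qed.

Definition tensv (U : {vspace V}) (X : {vspace W}) : {vspace tensor} :=
  <<[seq tens u x | u <- vbasis U, x <- vbasis X]>>%VS.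

Lemma tlift_mem (U : {vspace V}) (X : {vspace W}) (T : vectType k)
    (Y : {vspace T}) (b : V -> W -> T) t : bilin b ->
  (forall u x, u \in U -> x \in X -> b u x \in Y) ->
  t \in tensv U X -> tlift b t \in Y.
Proof.
move=> hb bY; rewrite /tensv; set s := [seq _ | _ <- _, _ <- _].
rewrite -[s]/(in_tuple s : seq _) => /coord_span->.
rewrite linear_sum; apply: rpred_sum => i _; rewrite linearZ rpredZ //=.
have /allpairsP[[u x] /= [Uu Xx ->]] : s`_i \in s by rewrite mem_nth.
by rewrite tliftE // bY // vbasis_mem.
Qed.

End Tensor.

Section QuotientSpace.
Variables (k : fieldType) (V : vectType k) (S : {vspace V}).

(* V / S, realized on a complement of S; qproj is the canonical surjection.   *)
Definition quotv : vectType k := subvs_of (S^C)%VS.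
Definition qproj (v : V) : quotv := vsproj (S^C)%VS (v - projv S v).

Lemma qproj_linear : linear qproj.
Proof.
by move=> c u v; rewrite /qproj linearP opprD addrACA -scalerN -scalerDr linearP.
Qed.
HB.instance Definition _ := GRing.isLinear.Build k V quotv *:%R qproj qproj_linear.

Lemma qprojK : cancel (vsval : quotv -> V) qproj.
Proof.
move=> q; apply/val_inj; rewrite /= vsprojK ?memv_projC //.
apply/eqP; rewrite subr_eq addrC -subr_eq subrr eq_sym.
have := memv_proj S (vsval q).
have : projv S (vsval q) \in (S^C)%VS.
  by rewrite -[projv _ _](subKr (vsval q)) rpredB ?memv_projC ?subvsP.
by move=> h1 h2; rewrite -memv0 -(capv_compl S) memv_cap h2.
Qed.

Lemma qproj_eq0 v : (qproj v == 0) = (v \in S).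
Proof.
apply/eqP/idP=> [/(congr1 val)|Sv].
  rewrite /= vsprojK ?memv_projC // => /eqP.
  by rewrite subr_eq0 => /eqP ->; apply: memv_proj.
by rewrite /qproj projv_id // subrr linear0.
Qed.

Lemma qprojD v : vsval (qproj v) - v \in S.
Proof. by rewrite -qproj_eq0 linearB /= qprojK subrr. Qed.

End QuotientSpace.

Section Modules.
Variable k : fieldType.

Record fdModule (A : falgType k) := FdModule {
  fdm_sort :> vectType k;
  fdm_act : A -> fdm_sort -> fdm_sort;
  fdm_actl : forall v, linear (fdm_act^~ v);
  fdm_actr : forall a, linear (fdm_act a);
  fdm_act1 : forall v, fdm_act 1 v = v;
  fdm_actM : forall a b v, fdm_act (a * b) v = fdm_act a (fdm_act b v) }.

Record fdBimodule (B A : falgType k) := FdBimodule {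
  fdb_sort :> vectType k;
  fdb_lact : B -> fdb_sort -> fdb_sort;
  fdb_ract : fdb_sort -> A -> fdb_sort;
  fdb_lactl : forall x, linear (fdb_lact^~ x);
  fdb_lactr : forall b, linear (fdb_lact b);
  fdb_lact1 : forall x, fdb_lact 1 x = x;
  fdb_lactM : forall b c x, fdb_lact (b * c) x = fdb_lact b (fdb_lact c x);
  fdb_ractl : forall a, linear (fdb_ract^~ a);
  fdb_ractr : forall x, linear (fdb_ract x);
  fdb_ract1 : forall x, fdb_ract x 1 = x;
  fdb_ractM : forall x a c, fdb_ract x (a * c) = fdb_ract (fdb_ract x a) c;
  fdb_actA : forall b x a, fdb_lact b (fdb_ract x a) = fdb_ract (fdb_lact b x) a }.

Section Basics.
Variable A : falgType k.
Implicit Types M N : fdModule A.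

Definition submodule M (U : {vspace M}) :=
  forall a v, v \in U -> fdm_act a v \in U.

Definition irreducible M :=
  {:M}%VS != 0%VS /\
  forall U : {vspace M}, submodule U -> U = 0%VS \/ U = {:M}%VS.

Definition completely_reducible M :=
  forall U : {vspace M}, submodule U ->
  exists W : {vspace M},
    [/\ submodule W, (U + W = {:M})%VS & (U :&: W = 0)%VS].

Definition fdm_iso M N :=
  exists f : 'Hom(M, N),
    bijective f /\ forall a v, f (fdm_act a v) = fdm_act a (f v).

Program Definition zero_mod : fdModule A :=
  @FdModule A 'rV[k]_0 (fun _ v => v) _ _ _ _.
Next Obligation. by move=> v c a b; apply/rowP=> -[]. Qed.
Next Obligation. by []. Qed.
Next Obligation. by []. Qed.
Next Obligation. by []. Qed.

Program Definition dirsum M N : fdModule A :=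
  @FdModule A (M * N)%type (fun a x => (fdm_act a x.1, fdm_act a x.2)) _ _ _ _.
Next Obligation. by move=> M N x c a b; congr (_, _); apply: fdm_actl. Qed.
Next Obligation. by move=> M N a c x y; congr (_, _); apply: fdm_actr. Qed.
Next Obligation. by move=> M N [x y]; rewrite /= !fdm_act1. Qed.
Next Obligation. by move=> M N a b x; rewrite /= !fdm_actM. Qed.

Definition bigdirsum (I : finType) (M_ : I -> fdModule A) : fdModule A :=
  \big[dirsum/zero_mod]_(i : I) M_ i.

Definition direct_summand M N := exists P, fdm_iso N (dirsum M P).

Program Definition regular_mod : fdModule A := @FdModule A A *%R _ _ _ _.
Next Obligation. by move=> v c a b; rewrite mulrDl scalerAl. Qed.
Next Obligation. by move=> a c u v; rewrite mulrDr scalerAr. Qed.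
Next Obligation. exact: mul1r. Qed.
Next Obligation. by move=> a b v; rewrite mulrA. Qed.

Definition semisimple_algebra := completely_reducible regular_mod.

End Basics.

Section TensorOver.
Variables (B A : falgType k) (X : fdBimodule B A) (M : fdModule A).

(* The image of X (x) (A (x) M) -> X (x) M,                                   *)
(* x (x) (a (x) m) |-> xa (x) m - x (x) am.                                   *)
Definition balancing : {vspace tensor X M} :=
  limg (linfun (tlift (fun (x : X) (y : tensor A M) =>
    tlift (fun a m => tens (fdb_ract x a) m - tens x (fdm_act a m)) y))).

Let bal (x : X) (a : A) (m : M) : tensor X M :=
  tens (fdb_ract x a) m - tens x (fdm_act a m).

Fact bal_bilin x : bilin (bal x).
Proof.
have [tl tr] := tens_bilin X M.
split=> [m c a b | a c m n]; rewrite /bal.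
  rewrite fdb_ractr tl fdm_actl tr.
  by rewrite opprD addrACA -scalerN -scalerDr.
rewrite fdm_actr !tr.
by rewrite opprD addrACA -scalerN -scalerDr.
Qed.

Fact bal_bilin2 : bilin (fun x y => tlift (bal x) y).
Proof.
have [tl tr] := tens_bilin X M.
split=> [y c x x' | x]; last exact: tlift_linear.
rewrite -tlift_lin; apply: eq_tlift => a m; rewrite /bal fdb_ractl !tl.
by rewrite opprD addrACA -scalerN -scalerDr.
Qed.

Lemma balancing_mem x a m :
  tens (fdb_ract x a) m - tens x (fdm_act a m) \in balancing.
Proof.
apply/memv_imgP; exists (tens x (tens a m)); first exact: memvf.
by rewrite lfunE /= tliftE ?tliftE //; [apply: bal_bilin | apply: bal_bilin2].
Qed.

Lemma balancing_ind (U : vectType k) (f : {linear tensor X M -> U})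
    (Y : {vspace U}) :
  (forall x a m, f (tens (fdb_ract x a) m - tens x (fdm_act a m)) \in Y) ->
  forall t, t \in balancing -> f t \in Y.
Proof.
move=> fY t /memv_imgP[s _ ->]; rewrite lfunE /= /tlift linear_sum.
apply: rpred_sum => i _; rewrite linear_sum; apply: rpred_sum => j _.
rewrite linearZ rpredZ // linear_sum; apply: rpred_sum => i' _.
rewrite linear_sum; apply: rpred_sum => j' _.
by rewrite linearZ rpredZ //; apply: fY.
Qed.

Definition tact (b : B) (t : tensor X M) : tensor X M :=
  tlift (fun x m => tens (fdb_lact b x) m) t.

Fact tact_bilin b : bilin (fun x m => tens (fdb_lact b x : X) (m : M)).
Proof.
have [tl tr] := tens_bilin X M.
by split=> [m c x y | x]; rewrite ?fdb_lactr ?tl //; apply: tr.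
Qed.

Fact tact_bal b t : t \in balancing -> tact b t \in balancing.
Proof.
apply: (@balancing_ind _ (tlift _)) => x a m.
rewrite linearB /= !(tliftE _ _ (tact_bilin b)) fdb_actA.
exact: balancing_mem.
Qed.

Definition tens_over_act (b : B) (q : quotv balancing) : quotv balancing :=
  qproj balancing (tact b (vsval q)).

Fact tens_over_actE b t :
  tens_over_act b (qproj balancing t) = qproj balancing (tact b t).
Proof.
apply/eqP; rewrite -subr_eq0 /tens_over_act -linearB /= qproj_eq0.
by rewrite /tact -linearB /=; apply: tact_bal; apply: qprojD.
Qed.

(* X \otimes_A M, with b (x (x) m) = bx (x) m *)
Program Definition tens_over : fdModule B :=
  @FdModule B (quotv balancing) tens_over_act _ _ _ _.
Next Obligation.
move=> q c a b; rewrite /tens_over_act -linearP; congr (qproj _ _).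
rewrite /tact -tlift_lin; apply: eq_tlift => x m.
by rewrite fdb_lactl (tens_bilin X M).1.
Qed.
Next Obligation. by move=> b c p q; rewrite /tens_over_act /tact !linearP. Qed.
Next Obligation.
move=> q; rewrite /tens_over_act -[RHS]qprojK; congr (qproj _ _).
rewrite -[RHS]/(idfun _).
apply: (@tensor_ext _ _ _ _ (tlift _) idfun) => x m /=.
by rewrite (tliftE _ _ (tact_bilin 1)) fdb_lact1.
Qed.
Next Obligation.
move=> a b q; rewrite -[tens_over_act b q]/(qproj _ (tact b (vsval q))).
rewrite tens_over_actE; congr (qproj _ _).
rewrite /tact.
apply: (@tensor_ext _ _ _ _ (tlift _) (tlift _ \o tlift _)) => x m /=.
by rewrite !(tliftE _ _ (tact_bilin _)) fdb_lactM.
Qed.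

End TensorOver.

End Modules.

Section TensorMaps.
Variable k : fieldType.

Definition tmap (V V' W W' : vectType k) (f : V -> V') (g : W -> W') :
    tensor V W -> tensor V' W' :=
  tlift (fun v w => tens (f v) (g w)).

Definition tassoc (U V W : vectType k) :
    tensor (tensor U V) W -> tensor U (tensor V W) :=
  tlift (fun x w => tlift (fun u v => tens u (tens v w)) x).

Definition tmul (A : falgType k) (s t : tensor A A) : tensor A A :=
  tlift (fun a b => tlift (fun c d => tens (a * c) (b * d)) t) s.

Lemma tlift_comp (V W U U' : vectType k) (f : U -> U') (b : V -> W -> U) t :
  linear f -> f (tlift b t) = tlift (fun v w => f (b v w)) t.
Proof.
move=> fl; pose h := GRing.isLinear.Build k U U' *:%R f fl.
pose g : {linear U -> U'} := HB.pack f h.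
rewrite -[f _]/(g _) linear_sum; apply: eq_bigr => i _.
by rewrite linear_sum; apply: eq_bigr => j _; rewrite linearZ.
Qed.

Lemma tlift_tmap (V V' W W' U : vectType k) (f : V -> V') (g : W -> W')
    (b : V' -> W' -> U) t : bilin b ->
  tlift b (tmap f g t) = tlift (fun v w => b (f v) (g w)) t.
Proof.
move=> hb; rewrite /tmap (tlift_comp _ _ (tlift_linear b)).
by apply: eq_tlift => v w; rewrite tliftE.
Qed.

Lemma tlift_tassoc (V W X U : vectType k) (F : V -> W -> X -> U) t :
  (forall w x, linear (fun v => F v w x)) -> (forall v, bilin (F v)) ->
  tlift (fun v y => tlift (F v) y) (tassoc t)
  = tlift (fun z x => tlift (fun v w => F v w x) z) t.
Proof.
move=> F1 F23; rewrite /tassoc (tlift_comp _ _ (tlift_linear _)).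
apply: eq_tlift => z x; rewrite (tlift_comp _ _ (tlift_linear _)).
apply: eq_tlift => v w; rewrite tliftE ?tliftE //; split=> [y c u u'|u].
  by rewrite -tlift_lin; apply: eq_tlift => ? ?; rewrite F1.
exact: tlift_linear.
Qed.

End TensorMaps.

HB.mixin Record Falgebra_isHopf (k : fieldType) H of Falgebra k H := {
  comul : 'Hom(H, tensor H H);
  counit : 'Hom(H, k^o);
  antipode : 'End(H);
  comulA : forall h : H,
    tassoc (tmap comul id (comul h)) = tmap id comul (comul h);
  counitl : forall h : H, tlift (fun a b => (counit a : k) *: b) (comul h) = h;
  counitr : forall h : H, tlift (fun a b => (counit b : k) *: a) (comul h) = h;
  comul1 : comul 1 = tens 1 1;
  comulM : forall g h : H, comul (g * h) = tmul (comul g) (comul h);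
  counit1 : counit 1 = 1;
  counitM : forall g h : H, counit (g * h) = counit g * counit h;
  antipodel : forall h : H,
    tlift (fun a b => antipode a * b) (comul h) = (counit h : k) *: 1;
  antipoder : forall h : H,
    tlift (fun a b => a * antipode b) (comul h) = (counit h : k) *: 1 }.

#[short(type="hopfType")]
HB.structure Definition Hopf (k : fieldType) :=
  { H of Falgebra_isHopf k H & Falgebra k H }.

Section HopfTheory.
Variables (k : fieldType) (H : hopfType k).

Definition subcoalgebra (C : {vspace H}) := (comul @: C <= tensv C C)%VS.

Record simpleSubcoalgebra := SimpleSubcoalgebra {
  ssc_space :> {vspace H};
  ssc_neq0 : ssc_space != 0%VS;
  ssc_sub : subcoalgebra ssc_space;
  ssc_simple : forall D : {vspace H},
    subcoalgebra D -> (D <= ssc_space)%VS -> D = 0%VS \/ D = ssc_space }.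

Definition ladj (h x : H) : H := tlift (fun a b => a * x * antipode b) (comul h).
Definition radj (h x : H) : H := tlift (fun a b => antipode a * x * b) (comul h).

(* {aspace H} only provides some unit, whence the condition 1 \in K.          *)
Record normalHopfSubalgebra := NormalHopfSubalgebra {
  nhs_space :> {aspace H};
  nhs_1 : 1 \in nhs_space;
  nhs_comul : subcoalgebra nhs_space;
  nhs_antipode : (antipode @: nhs_space <= nhs_space)%VS;
  nhs_ladj : forall h x, x \in nhs_space -> ladj h x \in nhs_space;
  nhs_radj : forall h x, x \in nhs_space -> radj h x \in nhs_space }.

Variable K : normalHopfSubalgebra.
Implicit Types C D : simpleSubcoalgebra.

(* K as an algebra in its own right; vsval is the inclusion into H.           *)
Definition nhs_alg : falgType k := Falgebra.clone k (subvs_of K) _.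

Fact nhs_val1 : vsval (1 : nhs_alg) = 1.
Proof. by apply/eqP; rewrite /= algid_eq1 nhs_1. Qed.

(* x c = c_(1) (S(c_(2)) x c_(3)) *)
Lemma radj_mul (x c : H) : tlift (fun a b => a * radj b x) (comul c) = x * c.
Proof.
pose F (a b d : H) := a * (antipode b * x * d).
have F1 b d : linear (fun a => F a b d).
  by move=> z u v; rewrite /F mulrDl scalerAl.
have F23 a : bilin (F a).
  split=> [d z u v | b z u v]; rewrite /F.
    by rewrite linearP !mulrDl mulrDr -!scalerAl -scalerAr.
  by rewrite !mulrDr -!scalerAr.
have F12 : bilin (fun a y => tlift (F a) y).
  split=> [y z u v | a]; last exact: tlift_linear.
  by rewrite -tlift_lin; apply: eq_tlift => ? ?; rewrite F1.
have F3 : bilin (fun z d => tlift (fun a b => F a b d) z).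
  split=> [d | y z u v]; first exact: tlift_linear.
  by rewrite -tlift_lin; apply: eq_tlift => ? ?; rewrite (F23 _).2.
transitivity (tlift (fun a y => tlift (F a) y) (tmap id comul (comul c))).
  rewrite tlift_tmap //; apply: eq_tlift => a b.
  by rewrite /radj (tlift_comp (f := *%R a)) // => z u v; rewrite mulrDr scalerAr.
rewrite -comulA tlift_tassoc // tlift_tmap //.
transitivity (tlift (fun a b : H => x * ((counit a : k) *: b)) (comul c)); last first.
  rewrite -(tlift_comp (f := *%R x)) ?counitl // => z u v.
  by rewrite mulrDr scalerAr.
apply: eq_tlift => a d.
transitivity (tlift (fun a1 a2 => a1 * antipode a2) (comul a) * (x * d)).
  rewrite (tlift_comp (f := *%R^~ (x * d))).
    by apply: eq_tlift => a1 a2; rewrite /F !mulrA.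
  by move=> z u v; rewrite mulrDl scalerAl.
by rewrite antipoder -scalerAl mul1r scalerAr.
Qed.

Lemma nhs_mulC C : (K * C <= C * K)%VS.
Proof.
apply/prodvP=> x c Kx Cc; rewrite -radj_mul.
apply: (tlift_mem (U := C) (X := C)).
- split=> [d z u v | b z u v]; first by rewrite mulrDl scalerAl.
  by rewrite /radj !linearP mulrDr scalerAr.
- by move=> a b Ca _; rewrite memv_mul // nhs_radj.
- by rewrite (subvP (ssc_sub C)) // memv_img.
Qed.

Fact coset_lstable C : (K * (C * K) <= C * K)%VS.
Proof.
rewrite prodvA; apply: subv_trans (prodvSl _ (nhs_mulC C)) _.
by rewrite -prodvA prodv_id.
Qed.

Fact coset_rstable C : (C * K * K <= C * K)%VS.
Proof. by rewrite -prodvA prodv_id. Qed.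

(* H as an (H, K)-bimodule and, below, CK as a (K, K)-bimodule; in the        *)
(* latter vsproj only restricts the codomain, by coset_lstable.               *)
Program Definition alg_bimod : fdBimodule H nhs_alg :=
  @FdBimodule k H nhs_alg H *%R (fun x a => x * vsval a)
    _ _ _ _ _ _ _ _ _.
Next Obligation. by move=> x c a b; rewrite mulrDl scalerAl. Qed.
Next Obligation. by move=> x c a b; rewrite mulrDr scalerAr. Qed.
Next Obligation. exact: mul1r. Qed.
Next Obligation. by move=> *; rewrite mulrA. Qed.
Next Obligation. by move=> x c a b; rewrite mulrDl scalerAl. Qed.
Next Obligation. by move=> x c a b; rewrite linearP mulrDr scalerAr. Qed.
Next Obligation. by move=> x; cbv beta; rewrite nhs_val1 mulr1. Qed.
Next Obligation. by move=> x a b; apply: mulrA. Qed.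
Next Obligation. by move=> *; rewrite mulrA. Qed.

Program Definition coset_bimod C : fdBimodule nhs_alg nhs_alg :=
  @FdBimodule k nhs_alg nhs_alg (subvs_of (C * K)%VS)
    (fun a x => vsproj (C * K)%VS (vsval a * vsval x))
    (fun x a => vsproj (C * K)%VS (vsval x * vsval a)) _ _ _ _ _ _ _ _ _.
Next Obligation. by move=> C x c a b; rewrite linearP mulrDl -scalerAl linearP. Qed.
Next Obligation. by move=> C x c a b; rewrite linearP mulrDr -scalerAr linearP. Qed.
Next Obligation. by move=> C x; cbv beta; rewrite nhs_val1 mul1r vsvalK. Qed.
Next Obligation.
move=> C a b x; cbv beta; rewrite vsprojK.
  by congr (vsproj _ _); symmetry; apply: mulrA.
by rewrite (subvP (coset_lstable C)) ?memv_mul ?subvsP.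
Qed.
Next Obligation. by move=> C x c a b; rewrite linearP mulrDl -scalerAl linearP. Qed.
Next Obligation. by move=> C x c a b; rewrite linearP mulrDr -scalerAr linearP. Qed.
Next Obligation. by move=> C x; cbv beta; rewrite nhs_val1 mulr1 vsvalK. Qed.
Next Obligation.
move=> C x a b; cbv beta; rewrite vsprojK.
  by congr (vsproj _ _); apply: mulrA.
by rewrite (subvP (coset_rstable C)) ?memv_mul ?subvsP.
Qed.
Next Obligation.
move=> C a x b; cbv beta; rewrite !vsprojK ?mulrA //.
  by rewrite (subvP (coset_lstable C)) ?memv_mul ?subvsP.
by rewrite (subvP (coset_rstable C)) ?memv_mul ?subvsP.
Qed.

Program Definition restrict (V : fdModule H) : fdModule nhs_alg :=
  @FdModule k nhs_alg V (fun a => fdm_act (vsval a)) _ _ _ _.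
Next Obligation. by move=> V v c a b; rewrite linearP fdm_actl. Qed.
Next Obligation. by move=> V a; apply: fdm_actr. Qed.
Next Obligation. by move=> V v; cbv beta; rewrite nhs_val1 fdm_act1. Qed.
Next Obligation. by move=> V a b v; apply: fdm_actM. Qed.

Definition induced (M : fdModule nhs_alg) : fdModule H :=
  tens_over alg_bimod M.

Definition conjugate C (M : fdModule nhs_alg) : fdModule nhs_alg :=
  tens_over (coset_bimod C) M.

Definition coset_equiv C D := (C <= D * K)%VS.

(* C_ picks exactly one simple subcoalgebra from each class, i.e. for each    *)
(* coset CK in H/K.                                                           *)
Definition coset_reps (I : finType) (C_ : I -> simpleSubcoalgebra) :=
  forall D, exists! i, coset_equiv D (C_ i).

End HopfTheory.

(* Main.v *)
(** Everything rests on the Larson-Radford theorem that a semisimple Hopf algebra H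
    in characteristic zero carries a functional l with l(h_1) h_2 = l(h) 1 = h_1 l(h_2)
    and l(1) = 1.  The functional l0(x) = Tr(y |-> S^2(y) x) is always a one-sided
    integral, and l0(1) = Tr(S^2).  Radford's formula gives S^4 = Ad(g) with g
    grouplike, hence of finite order, and S^2 is inner, S^2 = Ad(w^-1), with a power of
    w central.  Splitting 1 into minimal idempotents f_s commuting with w, one gets
    w f_s = mu_s f_s, and Tr(S^2) is the sum of the mu_t / mu_s over the pairs with
    f_s H f_t <> 0.  This relation is an equivalence and the quotients are roots of
    unity, so that in the complex numbers the sum is a sum of squared absolute values;
    the class of the augmentation contributes 1.

    The form l(x S(y)) separates subcoalgebras: X and Y meet trivially iff
    l(X S(Y)) = 0.  Since S(K) = K, this makes C <= DK symmetric in C and D and splits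
    H as the direct sum of the (K, K)-bimodules CK.  Tensoring with M gives (1); for
    (2), the component CK = K gives a retraction of H (x)_K M onto M, and the
    endomorphisms of H (x)_K M are controlled by the K-maps from M to the
    components. *)

From Stdlib Require Import Classical.
Require Import Defs.
From HB Require Import structures.
From mathcomp Require Import all_boot all_order all_algebra all_field.

Set Implicit Arguments.
Unset Strict Implicit.
Unset Printing Implicit Defensive.

Import GRing.Theory.
Local Open Scope ring_scope.

(** * Linear and bilinear maps *)

(** Semisimplicity of H enters only through two consequences: every x admits some y with x y x = x,
    and there is a two-sided integral L with eps(L) = 1. The integral serves twice: contracting
    against it turns functionals on H into elements, which is how l0 and S are studied, and
    averaging against it splits H-modules. The delicate point is Tr(S^2) <> 0. Conjugation by w is
    scalar on a corner f_s H f_t only when w acts by scalars on both idempotents, so minimality is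
    imposed among idempotents commuting with w; that f_s H f_s is nevertheless one-dimensional has
    to be earned from the central power of w. Moreover k need not embed in the complex numbers, so
    positivity is carried over by a resultant of integer polynomials. Finally, complete reducibility
    of K-modules is not derived from an integral of K: it descends from H-modules through the
    retraction of H (x)_K N onto N. *)

Section LinearMaps.
Variables (k : fieldType) (X : lmodType k).

Lemma linear_scale (W : lmodType k) (f : X -> W) c x :
  linear f -> f (c *: x) = c *: f x.
Proof.
move=> fl; have := fl (-1) 0 0; rewrite scaler0 addr0 scaleN1r addNr => f0.
by rewrite -[c *: x]addr0 fl f0 addr0.
Qed.

Lemma linear_big (W : lmodType k) (f : X -> W) I (r : seq I) (F : I -> X) :
  linear f -> f (\sum_(i <- r) F i) = \sum_(i <- r) f (F i).
Proof.
move=> fl; pose h := GRing.isLinear.Build k X W *:%R f fl.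
by pose g : {linear X -> W} := HB.pack f h; apply: (linear_sum g).
Qed.

Lemma linear_zero (W : lmodType k) (f : X -> W) : linear f -> f 0 = 0.
Proof. by move=> fl; rewrite -(scale0r 0) linear_scale // scale0r. Qed.

Lemma linear_comb (W : lmodType k) (f : X -> W) n (c : 'I_n -> k) (x : 'I_n -> X) :
  linear f -> f (\sum_i c i *: x i) = \sum_i c i *: f (x i).
Proof.
by move=> fl; rewrite linear_big //; apply: eq_bigr => i _; rewrite linear_scale.
Qed.

Lemma lin_id : linear (fun x : X => x). Proof. by []. Qed.

Lemma lin_lfun (U W : vectType k) (g : 'Hom(U, W)) (f : X -> U) :
  linear f -> linear (fun x => g (f x)).
Proof. by move=> fl c x y; rewrite fl linearP. Qed.

Lemma lin_mull (A : algType k) (f : X -> A) a :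
  linear f -> linear (fun x => a * f x).
Proof. by move=> fl c x y; rewrite fl mulrDr -scalerAr. Qed.

Lemma lin_mulr (A : algType k) (f : X -> A) a :
  linear f -> linear (fun x => f x * a).
Proof. by move=> fl c x y; rewrite fl mulrDl -scalerAl. Qed.

Lemma lin_scalel (U : lmodType k) (f : X -> k^o) (u : U) :
  linear f -> linear (fun x => (f x : k) *: u).
Proof. by move=> fl c x y; rewrite fl scalerDl scalerA. Qed.

Lemma lin_scaler (U : lmodType k) (f : X -> U) (a : k) :
  linear f -> linear (fun x => a *: f x).
Proof. by move=> fl c x y; rewrite fl scalerDr !scalerA mulrC. Qed.

Lemma lin_tensl (U W : vectType k) (f : X -> U) (w : W) :
  linear f -> linear (fun x => tens (f x) w).
Proof. by move=> fl c x y; rewrite fl (tens_bilin U W).1. Qed.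

Lemma lin_tensr (U W : vectType k) (f : X -> W) (u : U) :
  linear f -> linear (fun x => tens u (f x)).
Proof. by move=> fl c x y; rewrite fl (tens_bilin U W).2. Qed.

Lemma lin_tlift (U V W : vectType k) (F : X -> U -> V -> W) t :
  (forall u v, linear (fun x => F x u v)) -> linear (fun x => tlift (F x) t).
Proof.
by move=> Fl c x y; rewrite -tlift_lin; apply: eq_tlift => u v; rewrite Fl.
Qed.

Lemma lin_tliftr (U V W : vectType k) (F : U -> V -> W) (f : X -> tensor U V) :
  linear f -> linear (fun x => tlift F (f x)).
Proof. by move=> fl c x y; rewrite fl tlift_linear. Qed.

Lemma lin_sum (U : lmodType k) (I : Type) (r : seq I) (F : I -> X -> U) :
  (forall i, linear (F i)) -> linear (fun x => \sum_(i <- r) F i x).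
Proof.
move=> Fl c x y; rewrite scaler_sumr -big_split.
by apply: eq_bigr => i _; rewrite Fl.
Qed.

End LinearMaps.

(** Stated as an existence, so that the hom obtained by destructing it is opaque and computes only
    through its equation. *)
Lemma linear_hom (k : fieldType) (U W : vectType k) (f : U -> W) :
  linear f -> exists g : 'Hom(U, W), g =1 f.
Proof.
move=> fl; pose h := GRing.isLinear.Build k U W *:%R f fl.
by pose g : {linear U -> W} := HB.pack f h; exists (linfun g) => x; rewrite lfunE.
Qed.

Lemma tlift_sum (k : fieldType) (U V W : vectType k) I (r : seq I)
    (F : I -> U -> V -> W) t :
  tlift (fun a b => \sum_(i <- r) F i a b) t = \sum_(i <- r) tlift (F i) t.
Proof.
rewrite /tlift /=.
under eq_bigr do (under eq_bigr do rewrite scaler_sumr; rewrite exchange_big).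
by rewrite exchange_big.
Qed.

Lemma tlift_exchange (k : fieldType) (U V U' V' W : vectType k)
    (F : U -> V -> U' -> V' -> W) s t :
  tlift (fun a b => tlift (F a b) t) s
  = tlift (fun c d => tlift (fun a b => F a b c d) s) t.
Proof.
rewrite /tlift /=.
under eq_bigr do under eq_bigr do (rewrite scaler_sumr; under eq_bigr do rewrite scaler_sumr).
under [RHS]eq_bigr do under eq_bigr do (rewrite scaler_sumr;
  under eq_bigr do rewrite scaler_sumr).
under eq_bigr do (rewrite exchange_big; under eq_bigr do rewrite exchange_big).
rewrite exchange_big; apply: eq_bigr => c _.
rewrite exchange_big; apply: eq_bigr => d _.
apply: eq_bigr => i _; apply: eq_bigr => j _.
by rewrite !scalerA mulrC.
Qed.

Lemma lin_bilinl (k : fieldType) (X : lmodType k) (U V W : vectType k)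
    (F : U -> V -> W) (f : X -> U) v :
  bilin F -> linear f -> linear (fun x => F (f x) v).
Proof. by move=> Fb fl c x y; rewrite fl Fb.1. Qed.

Lemma lin_bilinr (k : fieldType) (X : lmodType k) (U V W : vectType k)
    (F : U -> V -> W) (f : X -> V) u :
  bilin F -> linear f -> linear (fun x => F u (f x)).
Proof. by move=> Fb fl c x y; rewrite fl Fb.2. Qed.

Lemma lin_comp (k : fieldType) (X U W : lmodType k) (g : U -> W) (f : X -> U) :
  linear g -> linear f -> linear (fun x => g (f x)).
Proof. by move=> gl fl c x y; rewrite fl gl. Qed.

(** * Sweedler sums *)

Section Sweedler.
Variables (k : fieldType) (H : hopfType k).
Implicit Types (U W : vectType k) (g h : H).

Local Notation S := (@antipode k H).
Local Notation eps := (@counit k H).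

(* \sum F h_(1) h_(2) *)
Definition sw U h (F : H -> H -> U) : U := tlift F (comul h).

Lemma eq_sw U h (F G : H -> H -> U) : (forall a b, F a b = G a b) -> sw h F = sw h G.
Proof. by move=> FG; apply: eq_tlift. Qed.

Lemma lin_sw U (X : lmodType k) (F : X -> H -> H -> U) h :
  (forall a b, linear (fun z => F z a b)) -> linear (fun z => sw h (F z)).
Proof. exact: lin_tlift. Qed.

Lemma lin_swl U (X : lmodType k) (F : H -> H -> U) (f : X -> H) :
  linear f -> linear (fun z => sw (f z) F).
Proof. by move=> fl c x y; rewrite /sw fl linearP tlift_linear. Qed.

End Sweedler.

(** Peels off the outermost construction of a one-variable expression. Moving maps in and out of
    Sweedler sums leaves such a linearity condition at nearly every step. *)
Ltac lin :=
  intros; cbv beta;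
  first
  [ solve [match goal with h : _ |- _ => exact: h end]
  | apply: lin_id
  | exact: linearP
  | apply: lin_lfun; lin
  | apply: lin_mull; lin
  | apply: lin_mulr; lin
  | apply: lin_scalel; lin
  | apply: lin_scaler; lin
  | apply: lin_tensl; lin
  | apply: lin_tensr; lin
  | apply: lin_sw; lin
  | apply: lin_swl; lin
  | apply: lin_tlift; lin
  | apply: lin_tliftr; lin
  | apply: lin_sum; lin
  | match goal with h : bilin ?F |- _ =>
      first [ apply: (lin_bilinl _ h); lin | apply: (lin_bilinr _ h); lin ] end
  | match goal with h : GRing.linear_for _ ?g |- _ =>
      apply: (lin_comp h); lin end ].

Ltac bilin_lin := split; intro; lin.
Ltac multilin := intros; first [lin | bilin_lin].

Section SweedlerTheory.
Variables (k : fieldType) (H : hopfType k).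
Implicit Types (U W : vectType k) (g h : H).

Local Notation S := (@antipode k H).
Local Notation eps := (@counit k H).

Lemma sw_comp U W h (f : U -> W) (F : H -> H -> U) :
  linear f -> f (sw h F) = sw h (fun a b => f (F a b)).
Proof. by move=> fl; apply: tlift_comp. Qed.

Lemma sw_sum U h I (r : seq I) (F : I -> H -> H -> U) :
  sw h (fun a b => \sum_(i <- r) F i a b) = \sum_(i <- r) sw h (F i).
Proof. exact: tlift_sum. Qed.

Lemma sw_exchange U g h (F : H -> H -> H -> H -> U) :
  sw g (fun a b => sw h (F a b)) = sw h (fun c d => sw g (fun a b => F a b c d)).
Proof. exact: tlift_exchange. Qed.

(** Coassociativity as a re-bracketing of nested sums. Trilinearity lets [F] factor through the
    triple tensor product, where [comulA] lives. *)
Lemma swA U h (F : H -> H -> H -> U) :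
  (forall b c, linear (fun a => F a b c)) -> (forall a, bilin (F a)) ->
  sw h (fun x c => sw x (fun a b => F a b c)) = sw h (fun a y => sw y (F a)).
Proof.
move=> F1 F2.
have F2b : bilin (fun a y => tlift (F a) y) by split=> [?|a]; lin.
transitivity (tlift (fun a y => tlift (F a) y) (tmap id comul (comul h))).
  rewrite -comulA tlift_tassoc // tlift_tmap //; split=> [b|y]; first by lin.
  by apply: lin_tlift => a b; case: (F2 a) => _; apply.
by rewrite tlift_tmap.
Qed.

Lemma sw_counitl U h (f : H -> U) :
  linear f -> sw h (fun a b => (eps a : k) *: f b) = f h.
Proof.
move=> fl; rewrite -[in RHS](counitl h) (tlift_comp _ _ fl).
by apply: eq_sw => a b; rewrite linear_scale.
Qed.

Lemma sw_counitr U h (f : H -> U) :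
  linear f -> sw h (fun a b => (eps b : k) *: f a) = f h.
Proof.
move=> fl; rewrite -[in RHS](counitr h) (tlift_comp _ _ fl).
by apply: eq_sw => a b; rewrite linear_scale.
Qed.

Lemma sw_antipodel U h (f : H -> U) :
  linear f -> sw h (fun a b => f (S a * b)) = (eps h : k) *: f 1.
Proof.
by move=> fl; rewrite -(linear_scale _ _ fl) -antipodel (tlift_comp _ _ fl).
Qed.

Lemma sw_antipoder U h (f : H -> U) :
  linear f -> sw h (fun a b => f (a * S b)) = (eps h : k) *: f 1.
Proof.
by move=> fl; rewrite -(linear_scale _ _ fl) -antipoder (tlift_comp _ _ fl).
Qed.

Lemma sw_tens h : sw h (fun a b => tens a b) = comul h.
Proof.
rewrite /sw -[RHS]/(idfun _).
by apply: (@tensor_ext _ _ _ _ (tlift _) idfun) => v w /=; rewrite tliftE //; apply: tens_bilin.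
Qed.

Lemma tmul_tens (a b c d : H) : tmul (tens a b) (tens c d) = tens (a * c) (b * d).
Proof.
have Fb u v : bilin (fun c d : H => tens (u * c) (v * d)) by bilin_lin.
by rewrite /tmul tliftE /= ?tliftE //; bilin_lin.
Qed.

Lemma swM U g h (F : H -> H -> U) : bilin F ->
  sw (g * h) F = sw g (fun a b => sw h (fun c d => F (a * c) (b * d))).
Proof.
move=> Fb; rewrite /sw comulM /tmul (tlift_comp _ _ (tlift_linear _)).
apply: eq_tlift => a b; rewrite (tlift_comp _ _ (tlift_linear _)).
by apply: eq_tlift => c d; rewrite tliftE.
Qed.

Lemma sw1 U (F : H -> H -> U) : bilin F -> sw 1 F = F 1 1.
Proof. by move=> Fb; rewrite /sw comul1 tliftE. Qed.

Lemma antipode1 : S 1 = 1.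
Proof.
have := sw_antipodel 1 (lin_id (X := H)).
rewrite sw1; last by bilin_lin.
by rewrite mulr1 counit1 scale1r.
Qed.

(* \sum S(g_1 h_1) g_2 h_2 S(h_3) S(g_3), evaluated in two ways. *)
Lemma antipodeM g h : S (g * h) = S h * S g.
Proof.
pose F g1 g2 g3 h1 h2 h3 := S (g1 * h1) * (g2 * (h2 * S h3) * S g3).
transitivity (sw g (fun g1 x => sw x (fun g2 g3 => sw h (fun h1 y => sw y (F g1 g2 g3 h1))))).
  rewrite -(sw_counitr g (f := fun z => S (z * h))); last by lin.
  apply: eq_sw => g1 x.
  under eq_sw => g2 g3.
    under eq_sw => h1 y.
      rewrite (sw_antipoder y (f := fun z => S (g1 * h1) * (g2 * z * S g3))); last by lin.
      rewrite mulr1.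
    over.
    rewrite (sw_counitr h (f := fun z => S (g1 * z) * (g2 * S g3))); last by lin.
  over.
  by rewrite (sw_antipoder x (f := fun z => S (g1 * h) * z)) ?mulr1 //; lin.
under eq_sw => g1 x do under eq_sw => g2 g3 do
  (rewrite -(swA h (F := F g1 g2 g3)) /F; [|multilin|multilin]).
rewrite -(swA g (F := fun g1 g2 g3 => sw h (fun y h3 => sw y (fun h1 h2 => F g1 g2 g3 h1 h2
  h3)))) /F; [|multilin|multilin].
under eq_sw => x g3.
  rewrite sw_exchange.
  under eq_sw => y h3.
    rewrite (@eq_sw _ _ _ _ _ (fun a b => sw y (fun c d => S (a * c) * (b * d) * (S h3 * S
      g3)))); last first.
      by move=> a b; apply: eq_sw => c d; rewrite !mulrA.
    rewrite -(swM x y (F := fun a b => S a * b * (S h3 * S g3))); last by multilin.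
    rewrite (sw_antipodel (x * y) (f := fun z => z * (S h3 * S g3))); last by multilin.
    rewrite counitM mul1r mulrC -scalerA.
  over.
  rewrite (sw_counitl h (f := fun z => _ *: (S z * S g3))); last by multilin.
over.
by rewrite (sw_counitl g (f := fun z => S h * S z)) //; lin.
Qed.

(* \sum comul(S(h_1)) (h_2 (x) h_3) (S(h_5) (x) S(h_4)), evaluated in two ways. *)
Lemma sw_antipode U h (F : H -> H -> U) : bilin F ->
  sw (S h) F = sw h (fun a b => F (S b) (S a)).
Proof.
move=> Fb; pose T a b c d e := sw (S a) (fun s t => F (s * (b * S e)) (t * (c * S d))).
transitivity (sw h (fun p z => sw p (fun a r =>
    sw r (fun b c => sw z (fun d e => T a b c d e))))); last first.
  (* With a, r running over comul p, the first three factors merge into comul(S(a) r), which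
     collapses to eps(p) times comul(1). *)
  under eq_sw => p z.
    rewrite (@eq_sw _ _ _ _ _ (fun a r =>
        sw (S a * r) (fun s t => sw z (fun d e => F (s * S e) (t * S d))))); last first.
      move=> a r; rewrite swM; last by multilin.
      rewrite /T sw_exchange; under eq_sw => d e do rewrite sw_exchange.
      rewrite [LHS]sw_exchange; apply: eq_sw => s t; rewrite [LHS]sw_exchange.
      by apply: eq_sw => b c; apply: eq_sw => d e; rewrite !mulrA.
    rewrite (sw_antipodel p (f := fun q => sw q _)); last by multilin.
    rewrite sw1; last by multilin.
    under [X in _ *: X]eq_sw do rewrite !mul1r.
  over.
  by rewrite (sw_counitl h (f := fun z => sw z _)) //; lin.
rewrite (swA h (F := fun a r z => sw r (fun b c => sw z (T a b c)))); [|rewrite /T;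
  multilin|rewrite /T; multilin].
rewrite -(sw_counitr h (f := fun z => sw (S z) F)); last by lin.
apply: eq_sw => a x.
rewrite (swA x (F := fun b c z => sw z (T a b c))); [|rewrite /T; multilin|rewrite /T; multilin].
under [RHS]eq_sw => b y.
  rewrite -(swA y (F := fun c d e => T a b c d e)); [|rewrite /T; multilin|rewrite /T; multilin].
  under eq_sw => q e.
    rewrite /T.
    rewrite (sw_antipoder q (f := fun c => sw (S a) (fun s t => F (s * (b * S e)) (t * c))));
      last by multilin.
    under [X in _ *: X]eq_sw do rewrite mulr1.
  over.
  rewrite (sw_counitl y (f := fun e => sw (S a) (fun s t => F (s * (b * S e)) t))); last by lin.
over.
rewrite (sw_antipoder x (f := fun z => sw (S a) (fun s t => F (s * z) t))); last by lin.
by congr (_ *: _); apply: eq_sw => s t; rewrite mulr1.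
Qed.

End SweedlerTheory.

(** * Traces *)

Lemma vbasis_nth_mem (k : fieldType) (V : vectType k) (U : {vspace V}) i :
  (vbasis U)`_i \in U.
Proof.
have [lt_i | ge_i] := ltnP i (size (vbasis U)); last by rewrite nth_default ?mem0v.
by rewrite vbasis_mem ?mem_nth.
Qed.

Section Trace.
Variables (k : fieldType) (V : vectType k).
Implicit Types f g : V -> V.

Definition tr f : k^o := \sum_i coord (vbasis {:V}) i (f (vbasis {:V})`_i).

Lemma eq_tr f g : f =1 g -> tr f = tr g.
Proof. by move=> fg; apply: eq_bigr => i _; rewrite fg. Qed.

Lemma lin_tr (X : lmodType k) (F : X -> V -> V) :
  (forall v, linear (fun x => F x v)) -> linear (fun x => tr (F x)).
Proof.
by move=> Fl c x y; rewrite /tr scaler_sumr -big_split; apply: eq_bigr => i _;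
  rewrite /= Fl linearP.
Qed.

Lemma tr_rank1 (l : V -> k^o) v : linear l -> tr (fun x => (l x : k) *: v) = l v.
Proof.
move=> ll; rewrite [in RHS](coord_vbasis (memvf v)) linear_big //.
by apply: eq_bigr => i _; rewrite linearZ /= (linear_scale _ _ ll) mulrC.
Qed.

Lemma trC f g : linear f -> linear g -> tr (fun x => f (g x)) = tr (fun x => g (f x)).
Proof.
pose e := vbasis {:V}.
have E : forall f g, linear f -> tr (fun x => f (g x)) =
    \sum_(i < \dim {:V}) \sum_(j < \dim {:V}) coord e j (g e`_i) * coord e i (f e`_j).
  move=> f' g' fl; apply: eq_bigr => i _; rewrite [in LHS](coord_vbasis (memvf (g' _))).
  rewrite linear_big // linear_sum; apply: eq_bigr => j _.
  by rewrite (linear_scale _ _ fl) linearZ.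
move=> fl gl; rewrite !E // exchange_big; apply: eq_bigr => i _.
by apply: eq_bigr => j _; rewrite mulrC.
Qed.

(** For a basis b of its image, an idempotent p is the sum of the rank-one maps x |-> b^i(p x) b_i,
    each of trace 1. *)
Lemma tr_id_proj (p : 'End(V)) : (forall x, p (p x) = p x) -> tr p = (\dim (limg p))%:R.
Proof.
move=> pp; pose b := vbasis (limg p).
have pb i : p b`_i = b`_i.
  by have /memv_imgP[y _ ->] : b`_i \in limg p := vbasis_nth_mem _ i; rewrite pp.
transitivity (\sum_i tr (fun x => (coord b i (p x) : k) *: b`_i)).
  rewrite /tr exchange_big; apply: eq_bigr => j _ /=.
  by rewrite [in LHS](coord_vbasis (memv_img p (memvf _))) linear_sum.
rewrite (eq_bigr (fun=> 1)); first by rewrite sumr_const card_ord.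
move=> i _; rewrite (tr_rank1 (l := fun x => coord b i (p x))); last by move=> c x y;
  rewrite !linearP.
by rewrite pb coord_free ?eqxx // (basis_free (vbasisP _)).
Qed.

End Trace.

(** * Integrals and Radford's formula *)

Section Integral.
Variables (k : fieldType) (H : hopfType k).
Implicit Types (U W : vectType k) (g h : H).

Local Notation S := (@antipode k H).
Local Notation eps := (@counit k H).

Variable L : H.
Hypothesis mulL : forall h, h * L = (eps h : k) *: L.
Hypothesis Lmul : forall h, L * h = (eps h : k) *: L.
Hypothesis epsL : eps L = 1.

(** Evaluate S(h_1) h_2 L_1 (x) h_3 L_2 in two ways: L absorbs h_2 and h_3 because comul(h L) =
    eps(h) comul(L), or S(h_1) h_2 collapses to the counit. *)
Lemma sw_integral_l U h (F : H -> H -> U) : bilin F ->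
  sw L (fun a b => F (S h * a) b) = sw L (fun a b => F a (h * b)).
Proof.
move=> Fb; rewrite -[RHS](sw_counitl h (f := fun z => sw L (fun a b => F a (z * b))));
  last by lin.
transitivity (sw h (fun x y => sw x (fun x1 x2 => sw L (fun a b => F (S x1 * (x2 * a)) (y *
  b))))).
  rewrite (swA h (F := fun x1 x2 y => sw L (fun a b => F (S x1 * (x2 * a)) (y * b))));
    [|multilin|multilin].
  rewrite -[LHS](sw_counitr h (f := fun z => sw L (fun a b => F (S z * a) b))); last by lin.
  apply: eq_sw => x y; rewrite -(swM y L (F := fun a b => F (S x * a) b)); last by multilin.
  by rewrite mulL (linear_scale (f := fun z => sw z _)) //; lin.
apply: eq_sw => x y; rewrite -[X in _ *: X](@eq_sw _ _ _ _ (fun a b => F (1 * a) (y * b)));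
  last by move=> a b; rewrite mul1r.
rewrite -(sw_antipodel x (f := fun z => sw L (fun a b => F (z * a) (y * b)))); last by lin.
by apply: eq_sw => x1 x2; apply: eq_sw => a b; rewrite mulrA.
Qed.

(** The mirror image, with L_1 h_1 (x) L_2 h_2 S(h_3). *)
Lemma sw_integral_r U h (F : H -> H -> U) : bilin F ->
  sw L (fun a b => F (a * h) b) = sw L (fun a b => F a (b * S h)).
Proof.
move=> Fb; rewrite -[LHS](sw_counitr h (f := fun z => sw L (fun a b => F (a * z) b)));
  last by lin.
transitivity (sw h (fun x y => sw y (fun y1 y2 => sw L (fun a b => F (a * x) (b * y1 * S y2))))).
  apply: eq_sw => x y; rewrite -[X in _ *: X](@eq_sw _ _ _ _ (fun a b => F (a * x) (b * 1)));
    last by move=> a b; rewrite mulr1.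
  rewrite -(sw_antipoder y (f := fun z => sw L (fun a b => F (a * x) (b * z)))); last by lin.
  by apply: eq_sw => y1 y2; apply: eq_sw => a b; rewrite mulrA.
rewrite -(swA h (F := fun x y1 y2 => sw L (fun a b => F (a * x) (b * y1 * S y2))));
  [|multilin|multilin].
rewrite -[RHS](sw_counitl h (f := fun z => sw L (fun a b => F a (b * S z)))); last by lin.
apply: eq_sw => x y; rewrite sw_exchange -(swM L x (F := fun a b => F a (b * S y)));
  last by multilin.
by rewrite Lmul (linear_scale (f := fun z => sw z _)) //; lin.
Qed.

(* The sums L_(2) p(L_(1)) and L_(1) p(L_(2)). *)
Definition contractl (p : H -> k^o) : H := sw L (fun a b => (p a : k) *: b).
Definition contractr (p : H -> k^o) : H := sw L (fun a b => (p b : k) *: a).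
(* Chosen so that contractl lam = 1 and contractr rho = 1, which makes both
   contractions injective; every identity about lam is then checked after contracting. *)
Definition lam (x : H) : k^o := tr (fun y => S (S y) * x).
Definition rho (x : H) : k^o := tr (fun y => x * S (S y)).

Lemma lam_linear : linear lam.
Proof. by apply: lin_tr => v; lin. Qed.
Lemma rho_linear : linear rho.
Proof. by apply: lin_tr => v; lin. Qed.

Lemma contractl_mull h p : linear p -> contractl (fun x => p (S h * x)) = h * contractl p.
Proof.
move=> pl; rewrite /contractl (sw_integral_l h (F := fun a b => (p a : k) *: b));
  last by multilin.
by rewrite (sw_comp _ _ (f := fun x => h * x)); [apply: eq_sw => a b; rewrite scalerAr | lin].
Qed.

Lemma contractl_mulr h p : linear p -> contractl (fun x => p (x * h)) = contractl p * S h.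
Proof.
move=> pl; rewrite /contractl (sw_integral_r h (F := fun a b => (p a : k) *: b));
  last by multilin.
by rewrite (sw_comp _ _ (f := fun x => x * S h)); [apply: eq_sw => a b; rewrite scalerAl | lin].
Qed.

Lemma contractr_mulr h p : linear p -> contractr (fun x => p (x * S h)) = contractr p * h.
Proof.
move=> pl; rewrite /contractr -(sw_integral_r h (F := fun a b => (p b : k) *: a));
  last by multilin.
by rewrite (sw_comp _ _ (f := fun x => x * h)); [apply: eq_sw => a b; rewrite scalerAl | lin].
Qed.

(** Write the trace in a basis e_i with dual basis e^i. By [contractl_mull] the contraction is the
    sum of S(e_i) e^i(L_1) L_2, that is S(L_1) L_2 = eps(L) 1. *)
Lemma contractl_lam : contractl lam = 1.
Proof.
pose e := vbasis {:H}.
transitivity (\sum_(i < \dim {:H}) S e`_i * contractl (coord e i)).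
  rewrite /contractl /lam /tr; under eq_sw do rewrite scaler_suml.
  rewrite sw_sum; apply: eq_bigr => i _.
  by rewrite -contractl_mull //; lin.
transitivity (sw L (fun a b => S a * b)); last first.
  by rewrite (sw_antipodel L (f := fun z => z)) ?epsL ?scale1r.
under [in RHS]eq_sw => a b do rewrite [in S a](coord_vbasis (memvf a)) linear_sum mulr_suml.
rewrite sw_sum; apply: eq_bigr => i _; rewrite /contractl (sw_comp _ _ (f := fun z => S e`_i *
  z)); last by lin.
by apply: eq_sw => a b; rewrite linearZ -scalerAl scalerAr.
Qed.

Lemma contractr_rho : contractr rho = 1.
Proof.
pose e := vbasis {:H}.
transitivity (\sum_(i < \dim {:H}) contractr (coord e i) * S e`_i).
  rewrite /contractr /rho /tr; under eq_sw do rewrite scaler_suml.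
  rewrite sw_sum; apply: eq_bigr => i _.
  by rewrite -contractr_mulr //; lin.
transitivity (sw L (fun a b => a * S b)); last first.
  by rewrite (sw_antipoder L (f := fun z => z)) ?epsL ?scale1r.
under [in RHS]eq_sw => a b do rewrite [in S b](coord_vbasis (memvf b)) linear_sum mulr_sumr.
rewrite sw_sum; apply: eq_bigr => i _; rewrite /contractr (sw_comp _ _ (f := fun z => z * S
  e`_i)); last by lin.
by apply: eq_sw => a b; rewrite linearZ -scalerAr scalerAl.
Qed.

(** The element x is itself a contraction, x = rho(L_2 S(x)) L_1, by [contractr_rho]; applying p and
    regrouping gives an explicit inverse of [contractl]. *)
Lemma contractlK p x : linear p -> p x = rho (contractl p * S x).
Proof.
move=> pl; have rl := rho_linear; have -> : p x = p (contractr (fun y => rho (y * S x))).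
  by rewrite contractr_mulr // contractr_rho mul1r.
rewrite /contractr (sw_comp _ _ (f := p)) //.
rewrite /contractl (sw_comp _ _ (f := fun z => rho (z * S x))); last by lin.
apply: eq_sw => a b; rewrite (linear_scale _ _ pl) -scalerAl (linear_scale _ _ rl).
exact: mulrC.
Qed.

Lemma contractrK p x : linear p -> p x = lam (S x * contractr p).
Proof.
move=> pl; have ll := lam_linear; have -> : p x = p (contractl (fun y => lam (S x * y))).
  by rewrite contractl_mull // contractl_lam mulr1.
rewrite /contractl (sw_comp _ _ (f := p)) //.
rewrite /contractr (sw_comp _ _ (f := fun z => lam (S x * z))); last by lin.
apply: eq_sw => a b; rewrite (linear_scale _ _ pl) -scalerAr (linear_scale _ _ ll).
exact: mulrC.
Qed.

Lemma contractl_inj p q : linear p -> linear q -> contractl p = contractl q -> p =1 q.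
Proof. by move=> pl ql pq x; rewrite contractlK // pq -contractlK. Qed.

Lemma contractl_scale c p : contractl (fun x => (c : k) *: p x) = c *: contractl p.
Proof.
by rewrite /contractl (sw_comp _ _ (f := fun z => c *: z)); [apply: eq_sw => a b;
  rewrite scalerA | lin].
Qed.

(** Indeed h = h (contractl lam) is the contraction of y |-> lam(S(h) y), so it depends on S(h)
    only. *)
Lemma antipode_inj h : S h = 0 -> h = 0.
Proof.
move=> Sh; rewrite -[h]mulr1 -contractl_lam -contractl_mull; last exact: lam_linear.
rewrite -[RHS](scale0r (contractl lam)) -contractl_scale; apply: eq_sw => a b.
by rewrite Sh mul0r scale0r -[X in lam X](scale0r 0) (linear_scale 0 0 lam_linear) !scale0r.
Qed.

Lemma antipode_surj h : exists g, S g = h.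
Proof.
have kS : lker S == 0%VS by apply/lker0P => x y /eqP;
  rewrite -subr_eq0 -linearB => /eqP /antipode_inj /eqP; rewrite subr_eq0 => /eqP.
by exists ((S^-1)%VF h); rewrite lker0_lfunVK.
Qed.

(** Test against a functional q and contract in h: the left side becomes lam(L_1) q(L_2) L_3, which
    is q (x) id applied to comul(contractl lam) = comul(1). *)
Lemma lam_left U h (f : H -> U) : linear f ->
  sw h (fun a b => (lam a : k) *: f b) = (lam h : k) *: f 1.
Proof.
have ll := lam_linear.
move=> fl; rewrite -[RHS](linear_scale (lam h : k) 1 fl).
transitivity (f (sw h (fun a b => (lam a : k) *: b))).
  by rewrite sw_comp //; apply: eq_sw => a b; rewrite (linear_scale _ _ fl).
congr (f _); have {f fl U} E q : linear q ->
    q (sw h (fun a b => (lam a : k) *: b)) = q ((lam h : k) *: 1) :> k^o.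
  move=> ql; rewrite sw_comp // (linear_scale _ _ ql).
  rewrite -[RHS]mulrC; move: h; apply: contractl_inj; [by multilin|by lin|].
  rewrite [RHS](contractl_scale (q 1)) contractl_lam.
  rewrite /contractl; under eq_sw => a b.
    rewrite (@eq_sw _ _ _ a _ (fun x y => (lam x : k) *: q y)); last by move=> x y;
      rewrite (linear_scale _ _ ql).
    rewrite (sw_comp _ _ (f := fun z : k^o => (z : k) *: b)); last by lin.
  over.
  rewrite (swA L (F := fun x y b => ((lam x : k) *: q y : k) *: b)); [|multilin|multilin].
  transitivity (sw (contractl lam) (fun x y => (q x : k) *: y)).
    rewrite /contractl (sw_comp _ _ (f := fun z => sw z _)); last by lin.
    apply: eq_sw => a y; rewrite (linear_scale (f := fun z => sw z _)); last by lin.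
    rewrite (sw_comp _ _ (f := fun z => _ *: z)); last by lin.
    by apply: eq_sw => x b; rewrite scalerA.
  by rewrite contractl_lam sw1 //; multilin.
rewrite (coord_vbasis (memvf (sw _ _))) (coord_vbasis (memvf (_ *: 1))).
by apply: eq_bigr => i _; rewrite E //; apply: linearP.
Qed.

Lemma lam_integral : lam L = 1.
Proof.
have ll := lam_linear.
have := congr1 eps contractl_lam; rewrite counit1 => <-.
rewrite /contractl (sw_comp _ _ (f := eps)); last by lin.
rewrite -[LHS](sw_counitr L ll); apply: eq_sw => a b.
by rewrite linearZ; apply: mulrC.
Qed.

(** The distinguished grouplike element. It measures how far [lam] is from being an integral on the
    other side, and is seen to be 1 in [haar_exists]. *)
Definition modular : H := contractr lam.
Local Notation g0 := modular.

(** The contraction of h |-> q(h_1) lam(h_2) is q(L_1) lam(L_2) L_3, which [lam_left] turns into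
    q(g0) 1. *)
Lemma lam_right U h (f : H -> U) : linear f ->
  sw h (fun a b => (lam b : k) *: f a) = (lam h : k) *: f g0.
Proof.
have ll := lam_linear.
move=> fl; rewrite -[RHS](linear_scale (lam h : k) g0 fl).
transitivity (f (sw h (fun a b => (lam b : k) *: a))).
  by rewrite sw_comp //; apply: eq_sw => a b; rewrite (linear_scale _ _ fl).
congr (f _); have {f fl U} E q : linear q ->
    q (sw h (fun a b => (lam b : k) *: a)) = q ((lam h : k) *: g0) :> k^o.
  move=> ql; rewrite sw_comp // (linear_scale _ _ ql).
  rewrite -[RHS]mulrC; move: h; apply: contractl_inj; [by multilin|by lin|].
  rewrite [RHS](contractl_scale (q g0)) contractl_lam.
  rewrite /contractl; under eq_sw => a b.
    rewrite (@eq_sw _ _ _ a _ (fun x y => (q x : k) *: lam y)); last first.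
      by move=> x y; rewrite (linear_scale _ _ ql); apply: mulrC.
    rewrite (sw_comp _ _ (f := fun z : k^o => (z : k) *: b)); last by lin.
  over.
  rewrite (swA L (F := fun x y b => ((q x : k) *: lam y : k) *: b)); [|multilin|multilin].
  transitivity (sw L (fun a y => ((q a : k) *: lam y : k) *: (1 : H))).
    apply: eq_sw => a y; rewrite -scalerA scalerA mulrC -scalerA.
    rewrite -(lam_left y (f := fun z => (q a : k) *: z)); last by lin.
    by apply: eq_sw => x b; rewrite !scalerA mulrC.
  rewrite -(sw_comp _ _ (f := fun z : k^o => (z : k) *: (1 : H))); last by lin.
  congr (_ *: _); rewrite /modular /contractr (sw_comp _ _ ql); apply: (@eq_sw k H k^o) => a b.
  by rewrite (linear_scale _ _ ql); apply: mulrC.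
rewrite (coord_vbasis (memvf (sw _ _))) (coord_vbasis (memvf (_ *: g0))).
by apply: eq_bigr => i _; rewrite E //; apply: linearP.
Qed.

(** By coassociativity comul(g0) is L_1 (x) L_2 lam(L_3), and [lam_right] replaces L_2 lam(L_3) by
    lam(L_2) g0. *)
Lemma sw_modular U (F : H -> H -> U) : bilin F -> sw g0 F = F g0 g0.
Proof.
have ll := lam_linear.
move=> Fb; rewrite {1}/modular /contractr (sw_comp _ _ (f := fun z => sw z F)); last by lin.
transitivity (sw L (fun x b => sw x (fun a c => (lam b : k) *: F a c))).
  apply: eq_sw => x b; rewrite (linear_scale (f := fun z => sw z F)); last by lin.
  by rewrite (sw_comp _ _ (f := fun z => _ *: z)) //; lin.
rewrite (swA L (F := fun a c b => (lam b : k) *: F a c)); [|multilin|multilin].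
rewrite [in RHS]/modular /contractr (sw_comp _ _ (f := fun z => F z g0)); last by lin.
apply: eq_sw => a y; rewrite lam_right; last by lin.
by rewrite (linear_scale (f := fun z => F z g0)) //; lin.
Qed.

Lemma counit_modular : eps g0 = 1.
Proof.
rewrite /modular /contractr (sw_comp _ _ (f := eps)); last by lin.
rewrite -lam_integral -[RHS](sw_counitl L lam_linear); apply: eq_sw => a b.
by rewrite linearZ; apply: mulrC.
Qed.

Lemma modularV : g0 * S g0 = 1.
Proof.
rewrite -(sw_modular (F := fun a b => a * S b)); last by multilin.
by rewrite (sw_antipoder g0 (f := fun z => z)) ?counit_modular ?scale1r.
Qed.

Lemma modularVl : S g0 * g0 = 1.
Proof.
rewrite -(sw_modular (F := fun a b => S a * b)); last by multilin.
by rewrite (sw_antipodel g0 (f := fun z => z)) ?counit_modular ?scale1r.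
Qed.

(** Contracting in x gives S(h) on both sides. *)
Lemma lam_nakayama x h : lam (x * h) = lam (S (S h) * x).
Proof.
have ll := lam_linear.
move: x; apply: contractl_inj; [by lin | by lin|].
by rewrite contractl_mulr // contractl_mull // contractl_lam mul1r mulr1.
Qed.

(** By [lam_right], p = lam(_ g0) is an integral on the other side ([pr]). Hence [contractr p] is a
    scalar, equal to p(L) = 1, and [contractrK] reads p(x) = lam(S(x)). *)
Lemma lam_antipode x : lam (S x) = lam (x * g0).
Proof.
have ll := lam_linear; pose p y := lam (y * g0).
have pl : linear p by rewrite /p; lin.
have pr U h (f : H -> U) : linear f -> sw h (fun a b => (p b : k) *: f a) = (p h : k) *: f 1.
  move=> fl; rewrite -modularV -(lam_right (h * g0) (f := fun z => f (z * S g0))); last by lin.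
  rewrite swM; last by multilin.
  apply: eq_sw => a b; rewrite sw_modular; last by multilin.
  by rewrite -mulrA modularV mulr1.
suff p1 : contractr p = 1 by rewrite -[RHS]/(p x) (contractrK x pl) p1 mulr1.
have <- : (eps (contractr p) : k) *: (1 : H) = 1.
  rewrite /contractr (sw_comp _ _ (f := eps)); last by lin.
  rewrite (@eq_sw _ _ _ _ _ (fun a b => (eps a : k) *: p b)); last by move=> a b;
    rewrite linearZ; apply: mulrC.
  rewrite sw_counitl // /p Lmul (linear_scale _ _ ll) lam_integral counit_modular.
  by rewrite !scale1r.
rewrite -[LHS](sw_counitl (contractr p) (f := fun z => z)) //.
rewrite {1}/contractr (sw_comp _ _ (f := fun z => sw z _)); last by lin.
transitivity (sw L (fun x b => sw x (fun a c => (p b : k) *: ((eps a : k) *: c)))).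
  apply: eq_sw => y b; rewrite (linear_scale (f := fun z => sw z _)); last by lin.
  by rewrite (sw_comp _ _ (f := fun z => _ *: z)) //; lin.
rewrite (swA L (F := fun a c b => (p b : k) *: ((eps a : k) *: c))); [|multilin|multilin].
rewrite [in RHS]/contractr (sw_comp _ _ (f := fun z => (eps z : k) *: (1 : H))); last by lin.
apply: eq_sw => a y; rewrite (pr _ y (fun c => (eps a : k) *: c)); last by lin.
have epsl : linear eps by apply: linearP.
by rewrite (linear_scale (p y : k) a epsl) scalerA.
Qed.

(* lam (b S^4(a) g0) = lam (S (b S^4(a))), and moving a around the product with the
   Nakayama automorphism S^2 turns this into lam (b g0 a). *)
Lemma antipode4 a : S (S (S (S a))) * g0 = g0 * a.
Proof.
have ll := lam_linear.
have E b : lam (b * (S (S (S (S a))) * g0)) = lam (b * (g0 * a)).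
  rewrite mulrA -lam_antipode antipodeM -lam_nakayama -antipodeM lam_antipode.
  by rewrite -mulrA -lam_nakayama mulrA.
apply/eqP; rewrite -subr_eq0; apply/eqP; set w := _ - _ in |- *.
have w0 b : lam (b * w) = 0 by rewrite mulrBr -scaleN1r addrC ll scaleN1r E addNr.
apply: antipode_inj; rewrite -[LHS]mul1r -contractl_lam -contractl_mulr //.
rewrite -[RHS](scale0r (contractl lam)) -contractl_scale; apply: eq_sw => x y.
by rewrite w0 !scale0r.
Qed.

End Integral.

(** * Sums of roots of unity *)

Section RootsOfUnity.
Import Order.TTheory Num.Theory.

Lemma closed_prim_root (k : closedFieldType) n :
  [pchar k] =i pred0 -> (0 < n)%N -> exists z : k, n.-primitive_root z.
Proof.
move=> ch0 n0; have n_neq0 : n%:R != 0 :> k by rewrite ((pcharf0P k).1 ch0) -lt0n.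
have [r pE] := closed_field_poly_normal ('X^n - 1 : {poly k}).
have mon : 'X^n - 1 \is @monic k by rewrite monicXnsubC.
move: pE; rewrite (monicP mon) scale1r => pE.
have ur : uniq r by rewrite -separable_prod_XsubC -pE separable_Xn_sub_1.
have sr : size r = n.
  by have := size_XnsubC (1 : k) n0; rewrite pE size_prod_XsubC => -[].
have : has n.-primitive_root r.
  apply: cyclic.has_prim_root => //; rewrite ?sr //.
  by apply/allP => z zr; rewrite /= [root_of_unity _ _]/root pE -/(root _ z) root_prod_XsubC.
by case/hasP=> z _ pz; exists z.
Qed.

(* Otherwise the resultant of [p] and [q] would be a nonzero integer vanishing in [k]. *)
Lemma int_poly_common_root (k : fieldType) (p q : {poly int}) (x : k) :
  [pchar k] =i pred0 -> p != 0 -> (1 < size q)%N ->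
  root (map_poly intr p) x -> root (map_poly intr q) x ->
  exists z : algC, root (map_poly intr p) z /\ root (map_poly intr q) z.
Proof.
move=> ch0 p0 sq px qx.
have intr_eqk (m : int) : (m%:~R == 0 :> k) = (m == 0).
  by case: m => m; rewrite ?NegzE ?mulrNz ?oppr_eq0 -pmulrn ((pcharf0P k).1 ch0).
have sp : (1 < size p)%N.
  rewrite ltnNge; apply/negP => /size1_polyC pE; move: px p0.
  by rewrite pE map_polyC /= rootC intr_eqk => /eqP ->; rewrite eqxx.
have [[u v] /= _ ruv] := resultant_in_ideal sp sq.
have : resultant p q == 0.
  rewrite -intr_eqk -(hornerC (resultant p q)%:~R x) -(map_polyC intr) /= ruv.
  by rewrite rmorphD !rmorphM hornerD !hornerM (rootP px) (rootP qx) !mulr0 addr0.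
rewrite resultant_eq0; set d := Pdiv.Idomain.gcdp p q => sd.
have inj0 (m : int) : (m%:~R == 0 :> algC) = (m == 0) by rewrite intr_eq0.
have mapX (r : {poly int}) z : Pdiv.Idomain.dvdp d r -> root (map_poly intr d) z ->
    root (map_poly intr r) (z : algC).
  case/Pdiv.Idomain.dvdpP=> -[c s] /= c0 E dz; have := congr1 (map_poly (intr : int -> algC)) E.
  rewrite -mul_polyC !rmorphM /= map_polyC => /(congr1 (horner^~ z)); rewrite !hornerM hornerC.
  by rewrite (rootP dz) mulr0 => /eqP; rewrite mulf_eq0 inj0 (negPf c0).
have /closed_rootP[z dz] : size (map_poly (intr : int -> algC) d) != 1%N.
  by rewrite size_map_inj_poly ?gtn_eqF // => a b /eqP;
    rewrite -subr_eq0 -rmorphB inj0 subr_eq0 => /eqP.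
by exists z; split; apply: mapX => //; [apply: Pdiv.Idomain.dvdp_gcdl | apply:
  Pdiv.Idomain.dvdp_gcdr].
Qed.

Lemma equivalence_repr (I : finType) (R : rel I) : equivalence_rel R ->
  exists c : I -> I, (forall i, R i (c i)) /\ (forall i j, R i j = (c i == c j)).
Proof.
move=> eqR; pose c i := odflt i [pick j | R i j].
have Rxx i : R i i := (eqR i i i).1.
have Rc i : R i (c i) by rewrite /c; case: pickP => //= /(_ i); rewrite Rxx.
exists c; split=> // i j; apply/idP/eqP => [Rij | cij].
  rewrite /c; have E : R i =1 R j by move=> l; apply: (eqR i j l).2.
  by rewrite (eq_pick E); case: pickP => //= /(_ j); rewrite Rxx.
by rewrite ((eqR i (c i) j).2 (Rc i)) cij -((eqR j (c j) j).2 (Rc j)).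
Qed.

Lemma equivalence_sum_ge1 (I : finType) (R : rel I) (u : I -> algC) i0 :
  equivalence_rel R -> (forall i, `|u i| = 1) -> (forall j, R i0 j -> j = i0) ->
  1 <= \sum_i \sum_(j | R i j) (u i)^* * u j.
Proof.
move=> /equivalence_repr[c [_ Rc]] u1 Ri0.
have -> : \sum_i \sum_(j | R i j) (u i)^* * u j = \sum_q `|\sum_(j | c j == q) u j| ^+ 2.
  transitivity (\sum_q \sum_(i | c i == q) \sum_(j | c j == q) (u i)^* * u j).
    rewrite (partition_big c xpredT) //=; apply: eq_bigr => q _.
    apply: eq_bigr => i /eqP <-; apply: eq_bigl => j; by rewrite Rc eq_sym.
  apply: eq_bigr => q _; rewrite normCK mulrC rmorph_sum mulr_suml.
  by apply: eq_bigr => i _; rewrite mulr_sumr.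
rewrite (bigD1 (c i0)) //= -[1]addr0 lerD //; last first.
  by apply: sumr_ge0 => q _; rewrite exprn_ge0.
rewrite (bigD1 i0) //= big1 ?addr0 ?u1 ?expr1n // => j /andP[].
by rewrite eq_sym -Rc => /Ri0 ->; rewrite eqxx.
Qed.

(* The quotients [u j / u i] are [n]-th roots of unity, so the sum is the value
   at a root of unity of a polynomial with integer coefficients, which takes
   values at least 1 at the [n]-th roots of unity in algC. *)
Lemma equivalence_sum_neq0 (k : closedFieldType) (I : finType) (R : rel I)
    (u : I -> k) n i0 :
  [pchar k] =i pred0 -> (0 < n)%N -> equivalence_rel R -> (forall i, u i != 0) ->
  (forall i j, R i j -> u i ^+ n = u j ^+ n) -> (forall j, R i0 j -> j = i0) ->
  \sum_i \sum_(j | R i j) (u i)^-1 * u j != 0.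
Proof.
move=> ch0 n0 eqR u0 un Ri0; have [c [Rcc Rc]] := equivalence_repr eqR.
have [z pz] := closed_prim_root ch0 n0.
have zc i : (u i / u (c i)) ^+ n = 1.
  by rewrite expr_div_n (un _ _ (Rcc i)) divff // expf_neq0.
(* Exponents are taken relative to the representative [c i] of the class: the u_i themselves need
   not be roots of unity, only their quotients within a class. *)
pose a i := sval (prim_rootP pz (zc i)).
have aE i : u i = z ^+ a i * u (c i).
  by rewrite /a; case: prim_rootP => /= l <-; rewrite divfK.
(* Since [a i] is less than n, the shift by n avoids a negative exponent without changing the value
   at n-th roots of unity. *)
pose p : {poly int} := \sum_i \sum_(j | R i j) 'X^(n - a i + a j).
have pE (F : fieldType) (x : F) : x ^+ n = 1 ->
    (map_poly intr p).[x] = \sum_i \sum_(j | R i j) (x ^+ a i)^-1 * x ^+ a j.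
  move=> xn; have x0 : x != 0 by apply/eqP => x0; move/eqP: xn;
    rewrite x0 expr0n gtn_eqF // eq_sym oner_eq0.
  rewrite rmorph_sum horner_sum; apply: eq_bigr => i _.
  rewrite rmorph_sum horner_sum; apply: eq_bigr => j _.
  rewrite /= map_polyXn hornerXn exprD; congr (_ * _); apply: (mulIf (expf_neq0 (a i) x0)).
  by rewrite -exprD subnK ?xn ?mulVf ?expf_neq0 // ltnW.
have pC (x : algC) : x ^+ n = 1 -> (map_poly intr p).[x] != 0.
  move=> xn; rewrite pE //.
  have x1 : `|x| = 1 by apply/eqP; rewrite -(@pexpr_eq1 _ _ n) // -normrX xn normr1.
  have xa i : `|x ^+ a i| = 1 by rewrite normrX x1 expr1n.
  have := equivalence_sum_ge1 eqR xa Ri0.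
  rewrite (eq_bigr (fun i => \sum_(j | R i j) (x ^+ a i)^-1 * x ^+ a j)); last first.
    move=> i _; apply: eq_bigr => j _; congr (_ * _).
    by rewrite invC_norm xa expr1n invr1 mul1r.
  by move=> ge1; rewrite gt_eqF // (lt_le_trans ltr01).
apply/negP => /eqP s0.
have p0 : p != 0 by apply: contra_neq (pC 1 (expr1n _ _)) => ->; rewrite rmorph0 horner0.
have q1 : (1 < size ('X^n - 1 : {poly int})%R)%N by rewrite size_XnsubC.
have qE (F : fieldType) (x : F) : root (map_poly intr ('X^n - 1)) x = (x ^+ n == 1).
  by rewrite rmorphB rmorph1 /= map_polyXn /root !hornerE subr_eq0.
have [||x [/rootP px]] := @int_poly_common_root k p _ z ch0 p0 q1.
- apply/rootP; rewrite pE ?prim_expr_order // -[RHS]s0; apply: eq_bigr => i _.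
  apply: eq_bigr => j; rewrite Rc => /eqP cij; rewrite [in RHS](aE i) [in RHS](aE j) -cij.
  rewrite invfM -mulrA; congr (_ * _); rewrite mulrCA mulrA mulfVK //.
- by rewrite qE prim_expr_order.
by rewrite qE => /eqP /pC; rewrite px eqxx.
Qed.

End RootsOfUnity.

(** * Minimal idempotents of von Neumann regular algebras *)

Lemma closed_eigenvector (k : closedFieldType) (V : vectType k) (U : {vspace V})
    (f : V -> V) :
  linear f -> U != 0%VS -> (forall x, x \in U -> f x \in U) ->
  exists x c, [/\ x \in U, x != 0 & f x = c *: x].
Proof.
move=> fl U0 fU; pose b := vbasis U.
have Ub i : b`_i \in U := vbasis_nth_mem U i.
pose A := \matrix_(i < \dim U, j < \dim U) coord b j (f b`_i).
have [a aA] : exists a, eigenvalue A a.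
  have /closed_rootP[a ra] : size (char_poly A) != 1%N by rewrite size_char_poly eqSS dimv_eq0.
  by exists a; rewrite eigenvalue_root_char.
have /eigenvalueP[v vA v0] := aA.
pose x := \sum_i v 0 i *: b`_i; exists x, a; split.
- by apply: rpred_sum => i _; rewrite rpredZ.
- apply: contra v0 => /eqP x0; apply/eqP/rowP => i; rewrite mxE.
  by have /freeP fr := basis_free (vbasisP U); apply: (fr (v 0) x0).
transitivity (\sum_j (v *m A) 0 j *: b`_j).
  rewrite /x linear_big //; under eq_bigr do rewrite (linear_scale _ _ fl).
  under [RHS]eq_bigr do rewrite mxE scaler_suml.
  rewrite exchange_big; apply: eq_bigr => i _.
  rewrite [f _](coord_vbasis (fU _ (Ub i))) scaler_sumr; apply: eq_bigr => j _.
  by rewrite scalerA mxE.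
by rewrite vA scaler_sumr; apply: eq_bigr => j _; rewrite mxE scalerA.
Qed.

Section RegularAlgebra.
Variables (k : closedFieldType) (A : falgType k).
Hypothesis ch0 : [pchar k] =i pred0.
Hypothesis regA : forall x : A, exists y, x * y * x = x.
Implicit Types x y z f g h : A.

Definition idem f := f * f = f.

Lemma tr_idem f : idem f -> f != 0 -> tr (fun x => f * x) != 0.
Proof.
move=> ff f0; pose p := amull f.
have pE x : p x = f * x by rewrite lfunE.
rewrite -(eq_tr pE) tr_id_proj ?((pcharf0P k).1 ch0) ?dimv_eq0; last first.
  by move=> x; rewrite !pE mulrA ff.
apply: contra f0 => /eqP p0; rewrite -ff -pE -memv0 -p0; apply: memv_img; apply: memvf.
Qed.

(** If x y x = x, then x y is a nonzero idempotent, whose trace is its rank. *)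
Lemma trace_form_neq0 x : x != 0 -> exists y, tr (fun z => x * y * z) != 0.
Proof.
move=> x0; have [y xyx] := regA x; exists y; apply: tr_idem.
  by rewrite /idem mulrA xyx.
by apply: contra x0 => /eqP xy0; rewrite -xyx xy0 mul0r.
Qed.

Lemma regular_corner f g x : idem f -> idem g -> x * f = x -> g * x = x ->
  exists y, [/\ f * y = y, y * g = y & x * y * x = x].
Proof.
move=> ff gg xf gx; have [y xyx] := regA x; exists (f * y * g).
by split; [rewrite !mulrA ff | rewrite -!mulrA gg | rewrite !mulrA xf -mulrA gx].
Qed.

Section Commutant.
Variable w : A.

(** Minimality is tested only against idempotents commuting with [w]; that the corner f A f is
    one-dimensional is [minidem_scalar]. *)
Definition minidem f := [/\ f != 0, idem f, f * w = w * f &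
  forall e, idem e -> e * w = w * e -> f * e = e -> e * f = e -> e = 0 \/ e = f].

Definition orth f g := (f * g == 0) && (g * f == 0).

(** Induction on the dimension of the right ideal f A: a non-minimal f splits as e + (f - e), and
    both parts generate strictly smaller ideals. *)
Lemma minidem_decomposition f : idem f -> f * w = w * f ->
  exists s : seq A, [/\ forall g, g \in s -> [/\ minidem g, f * g = g & g * f = g],
    pairwise orth s & \sum_(g <- s) g = f].
Proof.
have [n] := ubnP (\dim (limg (amull f))).
elim: n f => // n IHn f; rewrite ltnS => fn ff fw.
have [-> | f0] := eqVneq f 0; first by exists [::]; rewrite big_nil.
have [mf | nmf] := classic (minidem f).
  exists [:: f]; rewrite big_seq1; split=> // g; rewrite inE => /eqP ->.
  by rewrite ff.
have [e [ee ew fe ef [e0 eNf]]] : exists e, [/\ idem e, e * w = w * e,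
    f * e = e, e * f = e & e <> 0 /\ e <> f].
  apply: NNPP => h; apply: nmf; split=> // e ee ew fe ef; apply: NNPP => h'.
  by apply: h; exists e; split=> //; split=> h''; apply: h'; [left | right].
have dim_lt g : g != f -> idem g -> f * g = g -> g * f = g ->
    (\dim (limg (amull g)) < n)%N.
  move=> gf gg fg gf'; apply: leq_trans fn; rewrite ltnNge; apply/negP => le.
  have sub : (limg (amull g) <= limg (amull f))%VS.
    apply/subvP => _ /memv_imgP[x _ ->]; rewrite lfunE /= -fg -mulrA.
    by apply/memv_imgP; exists (g * x); rewrite ?memvf ?lfunE.
  have : f \in limg (amull g).
    have /eqP -> : limg (amull g) == limg (amull f).
      by rewrite eqEdim sub.
    by apply/memv_imgP; exists f; rewrite ?memvf ?lfunE.
  case/memv_imgP=> x _; rewrite lfunE /= => fE; case/eqP: gf.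
  by rewrite -gf' [in LHS]fE mulrA gg.
pose d := f - e.
have dd : idem d by rewrite /idem /d mulrBl !mulrBr ff fe ef ee subrr subr0.
have fd : f * d = d by rewrite mulrBr ff fe.
have df : d * f = d by rewrite mulrBl ff ef.
have dw : d * w = w * d by rewrite mulrBl mulrBr fw ew.
have ed : e * d = 0 by rewrite mulrBr ef ee subrr.
have de : d * e = 0 by rewrite mulrBl fe ee subrr.
have [|s1 [P1 O1 S1]] := IHn e _ ee ew; first by apply: dim_lt => //; apply/eqP.
have [|s2 [P2 O2 S2]] := IHn d _ dd dw.
  by apply: dim_lt => //; rewrite /d -subr_eq0 addrC addKr oppr_eq0; apply/eqP.
exists (s1 ++ s2); split.
- move=> g; rewrite mem_cat => /orP[/P1|/P2] [mg eg ge]; split=> //.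
  + by rewrite -eg mulrA fe.
  + by rewrite -ge -mulrA ef.
  + by rewrite -eg mulrA fd.
  + by rewrite -ge -mulrA df.
- rewrite pairwise_cat O1 O2 !andbT; apply/allrelP => g h /P1[_ eg ge] /P2[_ dh hd].
  have gh0 : g * h = 0 by rewrite -ge -dh mulrA -(mulrA g) ed mulr0 mul0r.
  have hg0 : h * g = 0 by rewrite -hd -eg mulrA -(mulrA h) de mulr0 mul0r.
  by rewrite /orth gh0 hg0 eqxx.
by rewrite big_cat /= S1 S2 addrC subrK.
Qed.

Variables (n : nat) (wV : A).
Hypothesis n_gt0 : (0 < n)%N.
Hypothesis wK : wV * w = 1.
Hypothesis wn_central : forall x, x * w ^+ n = w ^+ n * x.

Lemma idem_eigenvector f (u : A) : idem f -> f != 0 -> f * u = u * f ->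
  exists x c, [/\ f * x = x, x != 0 & u * x = c *: x].
Proof.
move=> ff f0 fu; have [||y|x [c [fx x0 ux]]] := @closed_eigenvector k A (limg (amull f)) ( *%R u).
- by move=> c x y; rewrite mulrDr scalerAr.
- apply: contra f0 => /eqP U0; rewrite -memv0 -U0; apply/memv_imgP.
  by exists f; rewrite ?memvf ?lfunE.
- case/memv_imgP=> x _ ->; rewrite lfunE /= mulrA -fu -mulrA.
  by apply/memv_imgP; exists (u * x); rewrite ?memvf ?lfunE.
exists x, c; split=> //; case/memv_imgP: fx => y _ ->.
by rewrite lfunE /= mulrA ff.
Qed.

(** The replacement for Schur's lemma: a y is an idempotent below g. If it is 0 then y = y a y = 0;
    if it is g then x = g x = a y x = 0. *)
Lemma minidem_eq0 g y a x : minidem g -> g * y = y -> y * g = y ->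
  g * a = a -> a * g = a -> y * a * y = y ->
  (a * y) * w = w * (a * y) -> g * x = x -> x != 0 -> y * x = 0 -> y = 0.
Proof.
move=> [g0 gg gw ming] gy yg ga ag yay ayw gx x0 yx.
have [||||ay0|ayg] := ming (a * y).
- by rewrite /idem mulrA -(mulrA a) -mulrA yay.
- by [].
- by rewrite mulrA ga.
- by rewrite -mulrA yg.
- by rewrite -yay -mulrA ay0 mulr0.
by case/eqP: x0; rewrite -gx -ayg -mulrA yx mulr0.
Qed.

(* The support of (w^n - c) g is an idempotent below g commuting with w. *)
Lemma minidem_commute_central g x c : minidem g -> g * x = x -> x != 0 ->
  w ^+ n * x = c *: x -> w ^+ n * g = c *: g.
Proof.
move=> mg gx x0 wx; have [g0 gg gw _] := mg.
pose y := w ^+ n * g - c *: g.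
have gy : g * y = y by rewrite mulrBr mulrA wn_central -mulrA -scalerAr gg.
have yg : y * g = y by rewrite mulrBl -mulrA -scalerAl gg.
have yC z : g * z = z -> z * g = z -> z * y = y * z.
  move=> gz zg; rewrite mulrBr mulrBl mulrA wn_central -!mulrA zg gz.
  by rewrite -scalerAr -scalerAl zg gz.
have [a [ga ag yay]] := regular_corner gg gg yg gy.
suff : y = 0 by move/eqP; rewrite subr_eq0 => /eqP.
have yx : y * x = 0 by rewrite mulrBl -mulrA gx wx -scalerAl gx subrr.
apply: (minidem_eq0 mg gy yg ga ag yay _ gx x0 yx).
have [w' w'E] : exists w', w' = w * g by exists (w * g).
have gw' : g * w' = w' by rewrite w'E mulrA gw -mulrA gg.
have w'g : w' * g = w' by rewrite w'E -mulrA gg.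
(* As y is central in the corner of g, the idempotent e = a y satisfies e w' = e w' e = w' e. *)
have E1 : a * y * w' * (a * y) = a * y * w'.
  by rewrite -(mulrA a y w') -(yC _ gw' w'g) -!mulrA (mulrA y a) yay.
have E2 : a * y * w' * (a * y) = w' * (a * y).
  have z1 : g * (w' * a) = w' * a by rewrite mulrA gw'.
  have z2 : w' * a * g = w' * a by rewrite -mulrA ag.
  rewrite -!mulrA (mulrA w') (yC _ z1 z2).
  by rewrite -[in RHS]yay -(yC _ ga ag) !mulrA.
transitivity (a * y * w'); first by rewrite -{1}yg w'E -gw !mulrA.
by rewrite -E1 E2 w'E -mulrA (mulrA g) ga.
Qed.

(** Scale w to v = w / c, where c is an eigenvalue of w on g A. The central power w^n gives v^n g =
    g, so the average e of the v^i g is an idempotent below g commuting with w. It fixes the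
    eigenvector, so it is nonzero and equals g; thus v g = g. *)
Lemma minidem_eigen g : minidem g -> exists2 c, c != 0 & w * g = c *: g.
Proof.
move=> mg; have [g0 gg gw ming] := mg.
have [x [c [gx x0 wx]]] := idem_eigenvector gg g0 gw.
have wnx m : w ^+ m * x = c ^+ m *: x.
  elim: m => [|m IHm]; first by rewrite !expr0 mul1r scale1r.
  by rewrite exprSr -mulrA wx -scalerAr IHm scalerA -exprS.
have c0 : c != 0.
  apply: contra x0 => /eqP c0; move: wx; rewrite c0 scale0r => wx.
  by rewrite -[x]mul1r -wK -mulrA wx mulr0.
have wng := minidem_commute_central mg gx x0 (wnx n).
exists c => //; have [v vE] : exists v, v = c^-1 *: w by exists (c^-1 *: w).
have vn : v ^+ n * g = g.
  by rewrite vE exprZn -scalerAl wng scalerA -exprMn mulVf // expr1n scale1r.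
have gv : g * v = v * g by rewrite vE -scalerAr gw scalerAl.
pose e := n%:R^-1 *: (\sum_(i < n) v ^+ i * g).
have n0 : n%:R != 0 :> k by rewrite ((pcharf0P k).1 ch0) -lt0n.
have gvi i : g * v ^+ i = v ^+ i * g by apply: commrX.
have ve : v * e = e.
  rewrite -scalerAr; congr (_ *: _); rewrite mulr_sumr.
  move: vn n_gt0; case: n => // m vm _; rewrite big_ord_recr [RHS]big_ord_recl /= addrC.
  rewrite mulrA -exprS vm expr0 mul1r; congr (_ + _).
  by apply: eq_bigr => i _; rewrite mulrA -exprS.
have ge : g * e = e.
  by rewrite -scalerAr mulr_sumr; congr (_ *: _); apply: eq_bigr => i _;
    rewrite mulrA gvi -mulrA gg.
have eg : e * g = e.
  by rewrite -scalerAl mulr_suml; congr (_ *: _); apply: eq_bigr => i _; rewrite -mulrA gg.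
have ex : e * x = x.
  rewrite -scalerAl mulr_suml (eq_bigr (fun=> x)); last first.
    move=> i _; rewrite -mulrA gx vE exprZn -scalerAl wnx scalerA -exprMn mulVf //.
    by rewrite expr1n scale1r.
  by rewrite sumr_const card_ord -scaler_nat scalerA mulVf // scale1r.
have vie i : v ^+ i * e = e by elim: i => [|i IHi]; rewrite ?mul1r // exprSr -mulrA ve.
have ee : idem e.
  rewrite /idem {1}/e -scalerAl mulr_suml (eq_bigr (fun=> e)); last first.
    by move=> i _; rewrite -mulrA ge.
  by rewrite sumr_const card_ord -scaler_nat scalerA mulVf // scale1r.
have ev : e * v = v * e.
  rewrite /e -scalerAl -scalerAr; congr (_ *: _); rewrite mulr_suml mulr_sumr.
  by apply: eq_bigr => i _; rewrite -mulrA gv !mulrA -exprSr -exprS.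
have ew : e * w = w * e.
  have wE : w = c *: v by rewrite vE scalerA divff // scale1r.
  by rewrite wE -scalerAr ev scalerAl.
have [e0|eE] := ming e ee ew ge eg.
  by case/eqP: x0; rewrite -ex e0 mul0r.
have : v * g = g by rewrite -{1}eE ve eE.
by rewrite vE -scalerAl => {2}<-; rewrite scalerA divff // scale1r.
Qed.

(** With c an eigenvalue of z on g A, y = z - c g kills a nonzero vector of g A, so [minidem_eq0]
    applies: w is scalar on g and so commutes with the whole corner. *)
Lemma minidem_scalar g z : minidem g -> g * z = z -> z * g = z -> exists c, z = c *: g.
Proof.
move=> mg gz zg; have [g0 gg gw ming] := mg.
have [x [c [gx x0 zx]]] := idem_eigenvector gg g0 (etrans gz (esym zg)).
pose y := z - c *: g; exists c.
have gy : g * y = y by rewrite mulrBr gz -scalerAr gg.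
have yg : y * g = y by rewrite mulrBl zg -scalerAl gg.
have [a [ga ag yay]] := regular_corner gg gg yg gy.
suff : y = 0 by move/eqP; rewrite subr_eq0 => /eqP.
have yx : y * x = 0 by rewrite mulrBl zx -scalerAl gx subrr.
apply: (minidem_eq0 mg gy yg ga ag yay _ gx x0 yx).
have [d _ wg] := minidem_eigen mg.
rewrite -[in LHS]yg -[in RHS]ga -!mulrA gw wg (mulrA w) wg -!scalerAr -!scalerAl.
by rewrite yg !mulrA ga.
Qed.

(** For a quasi-inverse y in the opposite corner, x y and y x are multiples of g and h, and x y x =
    x forces both factors to be 1. *)
Lemma minidem_sym g h x : minidem g -> minidem h -> g * x * h = x -> x != 0 ->
  exists y, [/\ h * y * g = y, x * y = g & y * x = h].
Proof.
move=> mg mh gxh x0; have [_ gg _ _] := mg; have [_ hh _ _] := mh.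
have gx : g * x = x by rewrite -gxh !mulrA gg.
have xh : x * h = x by rewrite -gxh -!mulrA hh.
have [y [hy yg xyx]] := regular_corner hh gg xh gx; exists y.
split; first by rewrite hy yg.
  have [||c xyE] := @minidem_scalar g (x * y) mg; rewrite ?mulrA ?gx -?mulrA ?yg //.
  move: xyx; rewrite xyE -scalerAl gx => /eqP; rewrite -subr_eq0 -[X in _ - X]scale1r -scalerBl.
  by rewrite scaler_eq0 (negPf x0) orbF subr_eq0 => /eqP ->; rewrite scale1r.
have [||c xyE] := @minidem_scalar h (y * x) mh; rewrite ?mulrA ?hy -?mulrA ?xh //.
move: xyx; rewrite -mulrA xyE -scalerAr xh => /eqP;
  rewrite -subr_eq0 -[X in _ - X]scale1r -scalerBl.
by rewrite scaler_eq0 (negPf x0) orbF subr_eq0 => /eqP ->; rewrite scale1r.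
Qed.

Lemma tr_corner0 g h : (forall x, g * x * h = 0) -> tr (fun x => g * x * h) = 0.
Proof. by move=> gxh; rewrite /tr big1 // => i _; rewrite gxh linear0. Qed.

(** With y the inverse of x, any z in the corner equals (z y) x, and z y is a multiple of g. So the
    corner is the line k x and the compression has rank one. *)
Lemma tr_corner1 g h x : minidem g -> minidem h -> g * x * h = x -> x != 0 ->
  tr (fun x => g * x * h) = 1.
Proof.
move=> mg mh gxh x0; have [y [hyg xy yx]] := minidem_sym mg mh gxh x0.
have [_ gg _ _] := mg; have [_ hh _ _] := mh.
have yg : y * g = y by rewrite -hyg -!mulrA gg.
pose l := coord [tuple x] ord0.
have lx : l x = 1 by rewrite /l -[X in coord _ _ X]/([tuple x]`_(ord0 : 'I_1)) coord_free
  ?seq1_free.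
rewrite (eq_tr (g := fun z => (l (g * z * h) : k) *: x)) => [|z]; last first.
  have [||c cE] := @minidem_scalar g (g * z * h * y) mg; rewrite ?mulrA ?gg //.
    by rewrite -[in LHS]mulrA yg.
  have -> : g * z * h = c *: x.
    have gx : g * x = x by rewrite -gxh !mulrA gg.
    transitivity (g * z * h * y * x); first by rewrite -(mulrA _ y x) yx -(mulrA _ h h) hh.
    by rewrite cE -scalerAl gx.
  by rewrite /l linearZ /= -[coord _ _ x]/(l x) lx mulr1.
rewrite (tr_rank1 (l := fun z => l (g * z * h))) ?gxh // => c u v.
by rewrite mulrDr mulrDl -scalerAr -scalerAl /l linearP.
Qed.

(* The algebra is the sum of the corners g_i A g_j, which have dimension at most 1. *)
Lemma tr_conj_neq0 (eps : A -> k) :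
  (forall x y, eps (x + y) = eps x + eps y) -> (forall x y, eps (x * y) = eps x * eps y) ->
  eps 1 = 1 -> tr (fun x => wV * x * w) != 0.
Proof.
move=> epsD epsM eps1.
have eps0 : eps 0 = 0 by apply: (addrI (eps 0)); rewrite -epsD !addr0.
have [s [Ps Os s1]] := @minidem_decomposition 1 (mulr1 1) (etrans (mul1r w) (esym (mulr1 w))).
pose g (i : 'I_(size s)) := s`_i.
have mg i : minidem (g i) by case: (Ps (g i)) => //; rewrite mem_nth.
have gort i j : i != j -> g i * g j = 0.
  have lt (i' j' : 'I_(size s)) : (i' < j')%N -> g i' * g j' = 0 /\ g j' * g i' = 0.
    by move=> lt; have /andP[/eqP ? /eqP] := pairwiseP 0 Os i' j' (ltn_ord i') (ltn_ord j') lt.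
  by rewrite neq_ltn => /orP[] /lt[].
have sumg : \sum_i g i = 1 by rewrite -[RHS]s1 (big_nth 0) big_mkord.
have gg i : g i * g i = g i by case: (mg i).
have [u uP] : exists u, forall i, u i != 0 /\ w * g i = u i *: g i.
  apply: (@fin_all_exists _ (fun=> k) (fun i c => c != 0 /\ w * g i = c *: g i)) => i.
  by have [c c0 cE] := minidem_eigen (mg i); exists c.
(* A boolean form of the condition that the corner g_i A g_j is nonzero. *)
pose R i j := tr (fun x => g i * x * g j) != 0.
have RP i j : R i j -> exists2 x, g i * x * g j = x & x != 0.
  move=> Rij; apply: NNPP => h; case/eqP: Rij; apply: tr_corner0 => x.
  apply/eqP/negPn/negP => x0; apply: h; exists (g i * x * g j) => //.
  by rewrite !mulrA gg -mulrA gg.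
have Rx i j x : g i * x * g j = x -> x != 0 -> R i j.
  by move=> gxg x0; rewrite /R (tr_corner1 (mg i) (mg j) gxg x0) oner_eq0.
have Rsym i j : R i j -> R j i.
  case/RP=> x gxg x0; have [y [gyg xy yx]] := minidem_sym (mg i) (mg j) gxg x0.
  apply: Rx gyg _; apply: contra (x0) => /eqP y0.
  by rewrite -gxg -xy y0 mulr0 !mul0r.
have Rtrans i j l : R i j -> R j l -> R i l.
  case/RP=> x gxg x0 /RP[z gzg z0].
  have [y [gyg xy yx]] := minidem_sym (mg i) (mg j) gxg x0.
  apply: (Rx i l (x * z)).
    have gx : g i * x = x by rewrite -gxg !mulrA gg.
    have zg : z * g l = z by rewrite -gzg -!mulrA gg.
    by rewrite mulrA gx -mulrA zg.
  apply: contra z0 => /eqP xz0.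
  by rewrite -gzg -yx -(mulrA y) xz0 mulr0 mul0r.
have eqR : equivalence_rel R.
  move=> i j l; split; first by apply: (Rx _ _ (g l)); rewrite ?gg //; case: (mg l).
  by move=> Rij; apply/idP/idP; [apply/Rtrans/Rsym | apply: Rtrans].
have [i0 epsi0] : exists i, eps (g i) != 0.
  apply/existsP; rewrite -[[exists _, _]]negbK negb_exists; apply/negP => /forallP h.
  move: (oner_neq0 k); rewrite -eps1 -sumg (big_morph eps epsD eps0) big1 ?eqxx // => i _.
  by apply/eqP; rewrite -[_ == _]negbK.
have Ri0 j : R i0 j -> j = i0.
  case/RP=> x gxg x0; have [y [gyg xy yx]] := minidem_sym (mg i0) (mg j) gxg x0.
  apply/eqP; rewrite eq_sym; apply/negPn/negP => /gort gij; case/eqP: epsi0.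
  (* Values of eps commute, so eps(x y) = eps(y x). If g_j and g_i0 were orthogonal, the square of
     eps(g_i0) would vanish. *)
  have E : eps (g j) = eps (g i0) by rewrite -xy -yx !epsM mulrC.
  by apply/eqP; rewrite -[_ == 0]orbb -mulf_eq0 -{2}E -epsM gij eps0.
(* Move the central element w^n across a nonzero x in g_i A g_j. *)
have unR i j : R i j -> u i ^+ n = u j ^+ n.
  case/RP=> x gxg x0.
  have wg m l : w ^+ m * g l = u l ^+ m *: g l.
    elim: m => [|m IHm]; first by rewrite !expr0 mul1r scale1r.
    by rewrite exprSr -mulrA (uP l).2 -scalerAr IHm scalerA -exprS.
  have gx : g i * x = x by rewrite -gxg !mulrA gg.
  have xg : x * g j = x by rewrite -gxg -!mulrA gg.
  have : u i ^+ n *: x = u j ^+ n *: x.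
    rewrite -[in LHS]gx scalerAl -wg -mulrA gx -wn_central -[in LHS]xg -mulrA.
    by rewrite wn_central wg -scalerAr xg.
  by move/eqP; rewrite -subr_eq0 -scalerBl scaler_eq0 (negPf x0) orbF subr_eq0 => /eqP.
have -> : tr (fun x => wV * x * w) = \sum_i \sum_(j | R i j) (u i)^-1 * u j; last first.
  by apply: (equivalence_sum_neq0 ch0 n_gt0 eqR _ unR Ri0) => i; case: (uP i).
have wVg i : wV * g i = (u i)^-1 *: g i.
  have [ui ug] := uP i; rewrite -[in RHS](mul1r (g i)) -wK -mulrA ug -scalerAr.
  by rewrite scalerA mulVf // scale1r.
rewrite (eq_tr (g := fun x => \sum_i \sum_j ((u i)^-1 * u j) *: (g i * x * g j))) => [|x];
  last first.
  have -> : wV * x * w = wV * (\sum_i g i) * x * (w * (\sum_i g i)).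
    by rewrite sumg !mulr1.
  rewrite [wV * _]mulr_sumr [w * _]mulr_sumr 2!mulr_suml.
  apply: eq_bigr => i _; rewrite mulr_sumr; apply: eq_bigr => j _.
  by rewrite wVg (uP j).2 -!scalerAr -!scalerAl scalerA mulrC.
rewrite /tr; under eq_bigr do rewrite linear_sum.
rewrite exchange_big; apply: eq_bigr => i _; under eq_bigr do rewrite linear_sum.
rewrite exchange_big [RHS]big_mkcond; apply: eq_bigr => j _ /=.
under eq_bigr do rewrite linearZ; rewrite -mulr_sumr -/(tr (fun x => g i * x * g j)).
case: ifPn => [/RP[x gxg x0] | /negbNE/eqP ->]; last exact: mulr0.
by rewrite (tr_corner1 (mg i) (mg j) gxg x0) mulr1.
Qed.

End Commutant.
End RegularAlgebra.

(** * The Larson-Radford theorem *)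

(** Split 1 = y x + v along A x and a complementary left ideal. Then x y x - x = - x v lies in both,
    hence is 0. *)
Lemma semisimple_regular (k : fieldType) (A : falgType k) :
  semisimple_algebra A -> forall x : A, exists y, x * y * x = x.
Proof.
move=> ssA x; have [|W [Wsub UW cap0]] := ssA (limg (amulr x)).
  move=> a _ /memv_imgP[y _ ->]; rewrite lfunE /= mulrA.
  by apply/memv_imgP; exists (a * y); rewrite ?memvf ?lfunE.
have : 1 \in (limg (amulr x) + W)%VS by rewrite UW memvf.
case/memv_addP=> u /memv_imgP[y _ ->] [v Wv]; rewrite lfunE /= => E; exists y.
apply/eqP; rewrite -subr_eq0 -memv0 -cap0 memv_cap; apply/andP; split.
  apply/memv_imgP; exists (x * y - 1); rewrite ?memvf // lfunE /=.
  by rewrite mulrBl mul1r.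
have -> : x * y * x - x = - (x * v).
  by apply/eqP; rewrite subr_eq addrC eq_sym subr_eq -[x in x == _]mulr1 E mulrDr mulrA addrC.
by rewrite rpredN; apply: (Wsub x v).
Qed.

Section LarsonRadford.
Variables (k : fieldType) (H : hopfType k).
Local Notation S := (@antipode k H).
Local Notation eps := (@counit k H).

(** A complement of the augmentation ideal yields a left integral. For x = L h - eps(h) L one has
    eps(x) = 0 and a x = eps(a) x, and x = x y x then forces x = 0, so L is two-sided. *)
Lemma semisimple_integral : semisimple_algebra H -> exists L : H,
  [/\ forall h, h * L = (eps h : k) *: L, forall h, L * h = (eps h : k) *: L & eps L = 1].
Proof.
move=> ssH; have [|W [Wsub UW cap0]] := ssH (lker eps).
  by move=> a v; rewrite !memv_ker counitM => /eqP ->; rewrite mulr0.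
have : 1 \in (lker eps + W)%VS by rewrite UW memvf.
case/memv_addP=> a; rewrite memv_ker => /eqP ea [L WL E].
have eL : eps L = 1 by rewrite -(counit1 (s := H)) E linearD /= ea add0r.
have mulL h : h * L = (eps h : k) *: L.
  apply/eqP; rewrite -subr_eq0 -memv0 -cap0 memv_cap memv_ker linearB linearZ /=.
  rewrite counitM eL subrr eqxx; apply: rpredB; [exact: (Wsub h L) | exact: rpredZ].
exists L; split=> // h; apply/eqP; rewrite -subr_eq0; apply/eqP.
set x := L * h - _; have ex : eps x = 0.
  by rewrite linearB linearZ /= counitM eL mul1r; apply/eqP; rewrite subr_eq0;
    apply/eqP/esym/mulr1.
have mulx y : y * x = (eps y : k) *: x.
  by rewrite mulrBr mulrA mulL -scalerAr mulL -scalerAl scalerBr !scalerA mulrC.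
have [y xyx] := semisimple_regular ssH x.
by rewrite -xyx -mulrA mulx -scalerAr mulx ex scale0r scaler0.
Qed.

Definition grouplike (g : H) := comul g = tens g g /\ eps g = 1.

Lemma sw_grouplike (U : vectType k) g (F : H -> H -> U) :
  grouplike g -> bilin F -> sw g F = F g g.
Proof. by move=> [dg _] Fb; rewrite /sw dg tliftE. Qed.

(** If g is the sum of c_i s_i, applying e^i (x) id to comul(g), with e^i the i-th coordinate, gives
    c_i g = c_i s_i. So every c_i is 0, against eps(g) = 1. *)
Lemma grouplike_free (s : seq H) : uniq s -> (forall g, g \in s -> grouplike g) -> free s.
Proof.
elim: s => [|g s IHs]; first by rewrite nil_free.
move=> /= /andP[gs us] gl.
have fs : free s by apply: IHs => // x xs; apply: gl; rewrite inE xs orbT.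
have gg : grouplike g by apply: gl; rewrite mem_head.
rewrite free_cons fs andbT; apply/negP => sg.
pose t := in_tuple s; pose c i := coord t i g.
have gE : g = \sum_i c i *: s`_i by apply: (coord_span (X := t)).
suff c0 i : c i = 0.
  have := gg.2; rewrite gE big1 => [|i _]; first by rewrite linear0 => /eqP;
    rewrite eq_sym oner_eq0.
  by rewrite c0 scale0r.
pose F (a b : H) := coord t i a *: b.
have Fb : bilin F.
  by split=> [b | a] d x y; rewrite /F ?linearP ?scalerDl ?scalerA // scalerDr !scalerA mulrC.
have := sw_grouplike gg Fb.
rewrite {1}gE (linear_big (f := fun z => sw z F)); last by lin.
rewrite (bigD1 i) //= big1 => [|j ji]; last first.
  rewrite (linear_scale (f := fun z => sw z F)); last by lin.
  rewrite sw_grouplike //; last by apply: gl; rewrite inE mem_nth ?orbT.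
  by rewrite /F coord_free // (negPf ji) scale0r scaler0.
rewrite (linear_scale (f := fun z => sw z F)); last by lin.
rewrite sw_grouplike //; last by apply: gl; rewrite inE mem_nth ?orbT.
rewrite /F coord_free // eqxx scale1r addr0 => /eqP; rewrite -subr_eq0 -scalerBr scaler_eq0.
case/orP=> [/eqP //|]; rewrite subr_eq0 => /eqP E.
by case/negP: gs; rewrite -E mem_nth.
Qed.

Lemma grouplikeX g n : grouplike g -> grouplike (g ^+ n).
Proof.
move=> [dg eg]; elim: n => [|n [dn en]]; first by rewrite /grouplike comul1 counit1.
by split; rewrite exprS ?comulM ?counitM ?dg ?dn ?tmul_tens ?eg ?en ?mulr1.
Qed.

(** Of the dim H + 1 powers from g^0 to g^(dim H) two coincide, since distinct grouplikes are
    independent; powers of h cancel the smaller one. *)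
Lemma grouplike_order g h : grouplike g -> g * h = 1 -> exists2 n, (0 < n)%N & g ^+ n = 1.
Proof.
move=> gg gh; pose s := [seq g ^+ i | i <- iota 0 (\dim {:H}).+1].
have /negP : ~ uniq s.
  move=> us; have fs : free s by apply: grouplike_free => // x /mapP[i _ ->]; apply: grouplikeX.
  have := dimvS (subvf <<s>>); rewrite (eqP fs) size_map size_iota.
  by rewrite ltnn.
case/(uniqPn 0)=> i [j []]; rewrite size_map size_iota => ij jd.
rewrite !(nth_map 0%N) ?size_iota ?(ltn_trans ij) // !nth_iota ?(ltn_trans ij) // !add0n => E.
exists (j - i)%N; first by rewrite subn_gt0.
have ghi : g ^+ i * h ^+ i = 1.
  elim: (i) => [|m IHm]; first by rewrite mulr1.
  by rewrite exprSr exprS mulrA -(mulrA _ g) gh mulr1.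
by rewrite -[LHS]mulr1 -ghi mulrA -exprD subnK ?(ltnW ij) // -E.
Qed.

End LarsonRadford.

(** * Nonvanishing of Tr(S^2) and the normalized integral on H *)

Section Haar.
Variables (k : closedFieldType) (H : hopfType k).
Hypothesis ch0 : [pchar k] =i pred0.
Hypothesis ssH : semisimple_algebra H.
Local Notation S := (@antipode k H).
Local Notation eps := (@counit k H).

(* For the regular character chi, w = chi(L_(1)) L_(2) satisfies h w = w S^2(h); it is
   invertible because the trace form of H is nondegenerate. *)
Lemma lam1_neq0 (L : H) : (forall h, h * L = (eps h : k) *: L) ->
  (forall h, L * h = (eps h : k) *: L) -> eps L = 1 -> lam (1 : H) != 0.
Proof.
move=> mulL Lmul epsL; pose chi (x : H) : k^o := tr (fun z => x * z).
have chil : linear chi by apply: lin_tr => v; lin.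
have chiC a b : chi (a * b) = chi (b * a).
  rewrite /chi (eq_tr (g := fun z => a * (b * z))) => [|z]; last by rewrite mulrA.
  rewrite (trC (f := *%R a) (g := *%R b)); try by lin.
  by apply: eq_tr => z; rewrite mulrA.
have [w wE] : exists w, w = contractl L chi by exists (contractl L chi).
have wS h : h * w = w * S (S h).
  rewrite wE -(contractl_mull mulL) // -(contractl_mulr Lmul) //.
  by apply: eq_sw => a b; rewrite chiC.
have w_inj a : a * w = 0 -> a = 0.
  rewrite wE -(contractl_mull mulL) // => aw0; apply: (antipode_inj mulL epsL).
  have {}aw0 : (fun x => chi (S a * x)) =1 (fun x => (0 : k) *: chi x).
    apply: (contractl_inj Lmul epsL); [by lin | by lin |].
    by rewrite contractl_scale scale0r.
  apply/eqP/negPn/negP => /(trace_form_neq0 ch0 (semisimple_regular ssH))[y].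
  by rewrite -/(chi (S a * y)) [chi _]aw0 scale0r eqxx.
have [wV wK] : exists wV, wV * w = 1.
  have kw : lker (amulr w) == 0%VS.
    apply/lker0P => x y; rewrite !lfunE /= => /eqP.
    by rewrite -subr_eq0 -mulrBl => /eqP /w_inj /eqP; rewrite subr_eq0 => /eqP.
  by exists ((amulr w)^-1%VF 1); rewrite -[RHS](lker0_lfunVK kw) [in RHS]lfunE.
pose g := modular L.
have gg : grouplike g.
  split; last exact: counit_modular.
  rewrite -sw_tens (sw_modular mulL Lmul epsL) //; exact: tens_bilin.
have gV := modularV mulL Lmul epsL.
have SSg : S (S g) = g.
  by rewrite -[LHS]mulr1 -(modularVl mulL Lmul epsL) mulrA -antipodeM gV antipode1 mul1r.
have gw : g * w = w * g by rewrite wS SSg.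
have [n n0 gn] := grouplike_order gg gV.
have zC x : x * (w * w * g) = w * w * g * x.
  by rewrite !mulrA (wS x) -(mulrA w _ w) (wS (S (S x))) -!mulrA (antipode4 mulL Lmul epsL).
(* Moving x past w w applies S^4, which g undoes, so w w g is central. As g commutes with w and g^n
   = 1, its n-th power is w^(2n). *)
have wn x : x * w ^+ (2 * n) = w ^+ (2 * n) * x.
  have -> : w ^+ (2 * n) = (w * w * g) ^+ n.
    rewrite exprMn_comm ?gn ?mulr1 ?exprM ?expr2 //.
    by rewrite /GRing.comm -mulrA -gw !mulrA gw.
  by apply: commrX; apply: zC.
have := tr_conj_neq0 ch0 (semisimple_regular ssH) (n := 2 * n) _ wK wn (eps := eps).
rewrite muln_gt0 n0 => /(_ isT (linearD eps) (@counitM _ H) (@counit1 _ H)).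
apply: contra => /eqP <-; apply/eqP/eq_tr => y.
by rewrite mulr1 -mulrA wS mulrA wK mul1r.
Qed.

(* The last clause, the Nakayama automorphism, comes from the construction. *)
Definition haar (l : H -> k^o) := [/\ linear l, l 1 = 1,
  forall (U : vectType k) h (f : H -> U), linear f ->
    sw h (fun a b => (l a : k) *: f b) = (l h : k) *: f 1,
  forall (U : vectType k) h (f : H -> U), linear f ->
    sw h (fun a b => (l b : k) *: f a) = (l h : k) *: f 1 &
  forall x h, l (x * h) = l (S (S h) * x)].

Lemma haar_exists : exists l, haar l.
Proof.
have [L [mulL Lmul epsL]] := semisimple_integral ssH.
have l1 := lam1_neq0 mulL Lmul epsL; have ll := @lam_linear _ H.
pose c : k := (lam (1 : H) : k)^-1.
have right (U : vectType k) h (f : H -> U) : linear f ->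
    sw h (fun a b => (lam b : k) *: f a) = (lam h : k) *: f 1.
  move=> fl; rewrite (lam_right mulL Lmul epsL) //; congr (_ *: f _).
  (* At h = 1 this reads lam(1) 1 = lam(1) g0, so the modular element is 1. *)
  have /eqP := lam_right mulL Lmul epsL 1 (f := fun z => z) (@lin_id _ _).
  rewrite sw1; last by multilin.
  by rewrite -subr_eq0 -scalerBr scaler_eq0 (negPf l1) subr_eq0 => /eqP.
exists (fun x => c *: lam x); split.
- by lin.
- exact: mulVf.
- move=> U h f fl; rewrite -scalerA -(lam_left mulL Lmul epsL) // sw_comp; last by lin.
  by apply: eq_sw => a b; rewrite -scalerA.
- move=> U h f fl; rewrite -scalerA -right // sw_comp; last by lin.
  by apply: eq_sw => a b; rewrite -scalerA.
by move=> x h; rewrite (lam_nakayama mulL Lmul epsL).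
Qed.

End Haar.

(** * Subcoalgebras *)

Lemma tens_mem (k : fieldType) (V W : vectType k) (U : {vspace V}) (X : {vspace W}) u x :
  u \in U -> x \in X -> tens u x \in tensv U X.
Proof.
move=> Uu Xx; rewrite (coord_vbasis Uu) (coord_vbasis Xx) (bilin_sum _ _ _ _ (tens_bilin V W)).
apply: rpred_sum => i _; apply: rpred_sum => j _; apply: rpredZ; apply: memv_span.
by apply/allpairsP; exists ((vbasis U)`_i, (vbasis X)`_j); rewrite !mem_nth ?size_tuple.
Qed.

(** The slices lying in U show that (projection to U) (x) id fixes t. Applied to the expansion of t
    along a basis of V, whose coefficients are slices in X, this map lands in U (x) X. *)
Lemma tensvP (k : fieldType) (V W : vectType k) (U : {vspace V}) (X : {vspace W})
    (t : tensor V W) :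
  (forall p : V -> k^o, linear p -> tlift (fun v w => (p v : k) *: w) t \in X) ->
  (forall p : W -> k^o, linear p -> tlift (fun v w => (p w : k) *: v) t \in U) ->
  t \in tensv U X.
Proof.
move=> tX tU; have tE : t = tlift (fun v w => tens v w) t.
  rewrite -[LHS]/(idfun _).
  by apply: (@tensor_ext _ _ _ _ idfun (tlift _)) => v w /=; rewrite tliftE //; apply: tens_bilin.
have ta : t = \sum_(i < \dim {:V}) tens (vbasis {:V})`_i
    (tlift (fun v w => coord (vbasis {:V}) i v *: w) t).
  rewrite {1}tE; under eq_tlift => v w do
    rewrite {1}(coord_vbasis (memvf v)) (linear_comb (f := fun v => tens v w) _ _ (lin_tensl w
      (@lin_id _ _))).
  rewrite tlift_sum; apply: eq_bigr => i _; rewrite (tlift_comp (f := tens _)); last by lin.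
  by apply: eq_tlift => v w; rewrite (linear_scale (f := tens _)) //; lin.
have tb : t = \sum_(j < \dim {:W}) tens
    (tlift (fun v w => coord (vbasis {:W}) j w *: v) t) (vbasis {:W})`_j.
  rewrite {1}tE; under eq_tlift => v w do
    rewrite {1}(coord_vbasis (memvf w)) (linear_comb _ _ (lin_tensr v (@lin_id _ _))).
  rewrite tlift_sum; apply: eq_bigr => j _; rewrite (tlift_comp (f := fun v => tens v _));
    last by lin.
  by apply: eq_tlift => v w; rewrite (linear_scale (f := fun v => tens v _)) //; lin.
pose G := tlift (fun v w => tens (projv U v) (w : W)).
have Gb : bilin (fun v w => tens (projv U v) (w : W)) by split=> ?; lin.
have Gt : G t = t.
  rewrite [in LHS]tb [RHS]tb /G linear_sum; apply: eq_bigr => j _.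
  by rewrite /= tliftE // projv_id // tU //; apply: linearP.
rewrite -Gt ta /G linear_sum; apply: rpred_sum => i _ /=.
by rewrite tliftE // tens_mem ?memv_proj // tX //; apply: linearP.
Qed.

Section Subcoalgebras.
Variables (k : fieldType) (H : hopfType k).
Local Notation S := (@antipode k H).
Local Notation eps := (@counit k H).
Implicit Types (X Y Z : {vspace H}).

Lemma sw_mem (U : vectType k) X (Y : {vspace U}) (F : H -> H -> U) x :
  subcoalgebra X -> x \in X -> bilin F ->
  (forall a b, a \in X -> b \in X -> F a b \in Y) -> sw x F \in Y.
Proof.
move=> sX Xx Fb FY; apply: (tlift_mem Fb FY); apply: (subvP sX).
exact: memv_img.
Qed.

Lemma subcoalgebraP X :
  (forall x (p : H -> k^o), x \in X -> linear p -> sw x (fun a b => (p a : k) *: b) \in X) ->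
  (forall x (p : H -> k^o), x \in X -> linear p -> sw x (fun a b => (p b : k) *: a) \in X) ->
  subcoalgebra X.
Proof.
move=> X1 X2; apply/subvP => _ /memv_imgP[x Xx ->].
by apply: tensvP => p pl; [apply: X1 | apply: X2].
Qed.

Lemma sw_meml X x (p : H -> k^o) : subcoalgebra X -> x \in X -> linear p ->
  sw x (fun a b => (p a : k) *: b) \in X.
Proof. by move=> sX Xx pl; apply: (sw_mem sX Xx) => [|a b _ Xb]; [multilin | apply: rpredZ]. Qed.

Lemma sw_memr X x (p : H -> k^o) : subcoalgebra X -> x \in X -> linear p ->
  sw x (fun a b => (p b : k) *: a) \in X.
Proof. by move=> sX Xx pl; apply: (sw_mem sX Xx) => [|a b Xa _]; [multilin | apply: rpredZ]. Qed.

Lemma subcoalgebra_cap X Y : subcoalgebra X -> subcoalgebra Y -> subcoalgebra (X :&: Y)%VS.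
Proof.
move=> sX sY; apply: subcoalgebraP => x p; rewrite memv_cap => /andP[Xx Yx] pl.
  by rewrite memv_cap !sw_meml.
by rewrite memv_cap !sw_memr.
Qed.

Lemma subcoalgebra_add X Y : subcoalgebra X -> subcoalgebra Y -> subcoalgebra (X + Y)%VS.
Proof.
move=> sX sY; apply: subcoalgebraP => _ p /memv_addP[x Xx [y Yy ->]] pl.
  by rewrite /sw linearD linearD memv_add ?sw_meml.
by rewrite /sw linearD linearD memv_add ?sw_memr.
Qed.

Lemma subcoalgebra0 : subcoalgebra (0%VS : {vspace H}).
Proof. by rewrite /subcoalgebra limg0 sub0v. Qed.

Lemma subcoalgebra_prod X Y : subcoalgebra X -> subcoalgebra Y -> subcoalgebra (X * Y)%VS.
Proof.
move=> sX sY; apply/subvP => _ /memv_imgP[h XYh ->]; rewrite memv_preim.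
move: h XYh; apply/subvP/prodvP => x y Xx Yy.
rewrite -memv_preim -sw_tens swM; last exact: tens_bilin.
apply: (sw_mem sX Xx) => [|a b Xa Xb]; first by multilin.
apply: (sw_mem sY Yy) => [|c d Yc Yd]; first by multilin.
by rewrite tens_mem ?memv_mul.
Qed.

Lemma subcoalgebra_simple X : subcoalgebra X -> X != 0%VS ->
  exists C : simpleSubcoalgebra H, (C <= X)%VS.
Proof.
have [n] := ubnP (\dim X); elim: n X => // n IHn X; rewrite ltnS => Xn sX X0.
have [sim | nsim] := classic (forall D, subcoalgebra D -> (D <= X)%VS -> D = 0%VS \/ D = X).
  by exists (SimpleSubcoalgebra X0 sX sim).
have [D [sD DX D0 DnX]] : exists D, [/\ subcoalgebra D, (D <= X)%VS, D <> 0%VS & D <> X].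
  apply: NNPP => h; apply: nsim => D sD DX; apply: NNPP => h'; apply: h; exists D.
  by split=> // E; apply: h'; [left | right].
have [||C CD] := IHn D _ sD; last by exists C; apply: subv_trans DX.
  apply: leq_trans Xn; rewrite ltn_neqAle dimvS // andbT.
  by apply: contra_notN DnX => /eqP dDX; apply/eqP; rewrite eqEdim DX dDX leqnn.
by apply/eqP.
Qed.

End Subcoalgebras.

(** * The form l(x S(y)) and disjointness of subcoalgebras *)

Section Orthogonality.
Variables (k : closedFieldType) (H : hopfType k).
Local Notation S := (@antipode k H).
Local Notation eps := (@counit k H).
Implicit Types (X Y Z : {vspace H}).

Variable l : H -> k^o.
Hypothesis hl : haar l.

(** Replace l(x S(y_1)) 1 by the integral applied to the second factor of comul(x S(y_1)). The
    antipode reverses comul(y_1), which puts the legs S(y_2) y_3 next to each other, and they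
    collapse. *)
Lemma haar_orth_l x y :
  sw y (fun y1 y2 => (l (x * S y1) : k) *: y2) = sw x (fun x1 x2 => (l (x2 * S y) : k) *: x1).
Proof.
have [ll _ _ lr _] := hl.
transitivity (sw y (fun y1 y2 => sw y1 (fun u v => sw x (fun x1 x2 =>
    (l (x2 * S u) : k) *: (x1 * (S v * y2)))))).
  apply: eq_sw => y1 y2; rewrite -{1}[y2]mul1r -(lr _ _ (fun a => a * y2)); last by lin.
  rewrite swM; last by multilin.
  under eq_sw => x1 x2 do (rewrite sw_antipode; last by multilin).
  rewrite sw_exchange; apply: eq_sw => u v; apply: eq_sw => x1 x2.
  by rewrite mulrA.
rewrite (swA y (F := fun u v y2 => sw x (fun x1 x2 => (l (x2 * S u) : k) *: (x1 * (S v *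
  y2))))); [|multilin|multilin].
rewrite -[RHS](sw_counitr y (f := fun z => sw x (fun x1 x2 => (l (x2 * S z) : k) *: x1)));
  last by lin.
apply: eq_sw => u z.
rewrite (sw_antipodel z (f := fun a => sw x (fun x1 x2 => (l (x2 * S u) : k) *: (x1 * a))));
  last by lin.
by congr (_ *: _); apply: eq_sw => x1 x2; rewrite mulr1.
Qed.

(** The same with the integral on the first factor. The legs to be cancelled are now S(x_2)
    S(S(x_1)) = S(S(x_1) x_2), whence the S^2 on the left side. *)
Lemma haar_orth_r x h :
  sw x (fun x1 x2 => (l (h * S x2) : k) *: S (S x1)) = sw h (fun h1 h2 => (l (h1 * S x) : k) *:
    h2).
Proof.
have [ll _ lle _ _] := hl.
transitivity (sw x (fun x1 x2 => sw x2 (fun u v => sw h (fun h1 h2 =>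
    (l (h1 * S v) : k) *: (h2 * (S u * S (S x1))))))).
  apply: eq_sw => x1 x2; rewrite -{1}[S (S x1)]mul1r -(lle _ _ (fun a => a * S (S x1)));
    last by lin.
  rewrite swM; last by multilin.
  under eq_sw => h1 h2 do (rewrite sw_antipode; last by multilin).
  rewrite sw_exchange; apply: eq_sw => u v; apply: eq_sw => h1 h2.
  by rewrite mulrA.
rewrite -(swA x (F := fun x1 u v => sw h (fun h1 h2 => (l (h1 * S v) : k) *: (h2 * (S u * S (S
  x1)))))); [|multilin|multilin].
rewrite -[RHS](sw_counitl x (f := fun z => sw h (fun h1 h2 => (l (h1 * S z) : k) *: h2)));
  last by lin.
apply: eq_sw => z v; under eq_sw do under eq_sw do rewrite -antipodeM.
rewrite (sw_antipodel z (f := fun a => sw h (fun h1 h2 => (l (h1 * S v) : k) *: (h2 * S a))));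
  last by lin.
by congr (_ *: _); apply: eq_sw => h1 h2; rewrite antipode1 mulr1.
Qed.

(* Both sides of haar_orth_l lie in X :&: Y. *)
Lemma haar_disjoint X Y x y : subcoalgebra X -> subcoalgebra Y ->
  (X :&: Y = 0)%VS -> x \in X -> y \in Y -> l (x * S y) = 0.
Proof.
have [ll _ _ _ _] := hl; move=> sX sY XY0 Xx Yy.
have E : sw y (fun y1 y2 => (l (x * S y1) : k) *: y2) = 0.
  apply/eqP; rewrite -memv0 -XY0 memv_cap {1}haar_orth_l.
  by rewrite (sw_memr (p := fun z => l (z * S y))) ?(sw_meml (p := fun z => l (x * S z))) //; lin.
rewrite -(sw_counitr y (f := fun z => l (x * S z))); last by lin.
have /(congr1 eps) := E; rewrite linear0 => <-; rewrite (sw_comp _ _ (f := eps)); last by lin.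
by apply: eq_sw => a b; rewrite linearZ; apply: mulrC.
Qed.

(** On the intersection, eps(z) = l(z_1 S(z_2)) vanishes, and z = eps(z_1) z_2. *)
Lemma haar_orthogonal X Y : subcoalgebra X -> subcoalgebra Y ->
  (forall x y, x \in X -> y \in Y -> l (x * S y) = 0) -> (X :&: Y = 0)%VS.
Proof.
have [ll l1 _ _ _] := hl; move=> sX sY XY0; have sXY := subcoalgebra_cap sX sY.
have eps0 z : z \in (X :&: Y)%VS -> eps z = 0.
  move=> zXY; have := sw_antipoder z ll; rewrite l1 => E.
  rewrite -[LHS]mulr1 -[_ * _]/((eps z : k) *: (1 : k^o)) -E.
  apply/eqP; rewrite -memv0; apply: (sw_mem sXY zXY); first by multilin.
  by move=> a b; rewrite !memv_cap memv0 => /andP[Xa _] /andP[_ Yb]; rewrite XY0.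
apply/eqP; rewrite -subv0; apply/subvP => z zXY; rewrite memv0.
rewrite -[z](sw_counitl z (f := fun a => a)) // -memv0.
by apply: (sw_mem sXY zXY); [multilin | move=> a b az _; rewrite eps0 // scale0r mem0v].
Qed.

(** [haar_orth_l] and [haar_orth_r] trade slices of h for slices of x, so the orthogonal of X is
    again a subcoalgebra. *)
Lemma perp_exists X : subcoalgebra X -> exists Y, [/\ subcoalgebra Y, (X :&: Y = 0)%VS,
  (X + Y = {:H})%VS & forall h : H, h \in Y <-> (forall x, x \in X -> l (h * S x) = 0)].
Proof.
have [ll _ _ _ _] := hl; move=> sX.
have [g gE] : exists g : 'Hom(H, 'rV[k]_(\dim X)),
    g =1 (fun h => \row_i l (h * S (vbasis X)`_i)).
  by apply: linear_hom => c x y; apply/rowP => i; rewrite !mxE mulrDl -scalerAl ll.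
pose Y := lker g.
have YP h : reflect (forall x, x \in X -> l (h * S x) = 0) (h \in Y).
  rewrite memv_ker gE; apply: (iffP eqP) => [E x Xx | h0].
    rewrite (coord_vbasis Xx) (linear_comb (f := fun x => l (h * S x))); last by lin.
    by rewrite big1 // => i _; have /= := congr1 (fun v : 'rV[k]_(\dim X) => v 0 i) E;
      rewrite !mxE => ->; rewrite scaler0.
  by apply/rowP => i; rewrite !mxE h0 // vbasis_nth_mem.
have sY : subcoalgebra Y.
  apply: subcoalgebraP => h p Yh pl; apply/YP => x Xx.
    transitivity (p (sw h (fun h1 h2 => (l (h2 * S x) : k) *: h1))).
      rewrite (sw_comp _ _ (f := fun z => l (z * S x))); last by lin.
      rewrite (sw_comp _ _ pl); apply: eq_sw => a b.
      by rewrite -scalerAl (linear_scale _ _ ll) (linear_scale _ _ pl); apply: mulrC.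
    rewrite -haar_orth_l -[RHS](linear_zero pl); congr (p _); apply/eqP.
    rewrite -memv0; apply: (sw_mem sX Xx); first by multilin.
    by move=> a b Xa _; rewrite (YP h Yh) // scale0r mem0v.
  transitivity (p (sw h (fun h1 h2 => (l (h1 * S x) : k) *: h2))).
    rewrite (sw_comp _ _ (f := fun z => l (z * S x))); last by lin.
    rewrite (sw_comp _ _ pl); apply: eq_sw => a b.
    by rewrite -scalerAl (linear_scale _ _ ll) (linear_scale _ _ pl); apply: mulrC.
  rewrite -haar_orth_r -[RHS](linear_zero pl); congr (p _); apply/eqP.
  rewrite -memv0; apply: (sw_mem sX Xx); first by multilin.
  by move=> a b _ Xb; rewrite (YP h Yh) // scale0r mem0v.
have XY0 : (X :&: Y = 0)%VS.
  by rewrite capvC; apply: haar_orthogonal => // y x Yy Xx; apply: (YP y Yy).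
exists Y; split=> //; last by move=> h; split=> [/YP //|h0]; apply/YP.
(* Y is the kernel of a map to a space of dimension dim X, so dim X + dim Y >= dim H. *)
apply/eqP; rewrite eqEdim subvf dimv_disjoint_sum //.
rewrite -(limg_ker_dim g fullv) capfv addnC leq_add2r.
by apply: leq_trans (dimvS (subvf _)) _; rewrite dimvf /dim /= mul1n.
Qed.

End Orthogonality.

(** * Cosets of a normal Hopf subalgebra *)

Section Cosets.
Variables (k : closedFieldType) (H : hopfType k).
Local Notation S := (@antipode k H).
Local Notation eps := (@counit k H).
Implicit Types (X Y Z : {vspace H}).

Variable l : H -> k^o.
Hypothesis hl : haar l.
Hypothesis S_inj : forall h, S h = 0 -> h = 0.
Variable K : normalHopfSubalgebra H.
Implicit Types C D E : simpleSubcoalgebra H.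

Lemma nhs_antipode_surj a : a \in nhs_space K -> exists2 b, b \in nhs_space K & S b = a.
Proof.
move=> Ka; have kS : lker S == 0%VS.
  apply/lker0P => x y /eqP; rewrite -subr_eq0 -linearB => /eqP /S_inj /eqP.
  by rewrite subr_eq0 => /eqP.
have SK : (S @: K)%VS = K.
  apply/eqP; rewrite eqEdim nhs_antipode limg_dim_eq ?leqnn //.
  by rewrite (eqP kS) capv0.
by move: Ka; rewrite -{1}SK => /memv_imgP[b Kb ->]; exists b.
Qed.

Definition bistable X := (K * X <= X)%VS /\ (X * K <= X)%VS.

Lemma coset_bistable C : bistable (C * K)%VS.
Proof. by split; [apply: coset_lstable | apply: coset_rstable]. Qed.

Lemma nhs_bistable : bistable K.
Proof. by rewrite /bistable prodv_id. Qed.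

(** This is the projection along the orthogonal of X, which contains every subcoalgebra meeting X
    trivially and inherits both K-actions. *)
Lemma bistable_projection X : subcoalgebra X -> bistable X -> exists p : 'End(H),
  [/\ forall h, p h \in X, forall x, x \in X -> p x = x,
      forall Z, subcoalgebra Z -> (X :&: Z = 0)%VS -> forall z, z \in Z -> p z = 0 &
      forall a h, a \in nhs_space K -> p (a * h) = a * p h /\ p (h * a) = p h * a].
Proof.
move=> sX [KX XK]; have [ll l1 _ _ lN] := hl.
have [Y [sY XY0 XYH YP]] := perp_exists hl sX.
pose p := daddv_pi X Y.
have pX h : p h \in X by apply: memv_pi.
have pid x : x \in X -> p x = x by apply: daddv_pi_id.
have add h : p h + daddv_pi Y X h = h by apply: daddv_pi_add; rewrite // XYH memvf.
have p0 y : y \in Y -> p y = 0.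
  by move=> Yy; apply/eqP; rewrite -[_ == _](inj_eq (addIr (daddv_pi Y X y))) add add0r
    daddv_pi_id // capvC.
exists p; split=> // [Z sZ XZ z Zz | a h Ka].
  apply: p0; apply/YP => x Xx; apply: (haar_disjoint hl sZ sX) => //.
  by rewrite capvC.
have [Yq Xp] : daddv_pi Y X h \in Y /\ p h \in X by split; apply: memv_pi.
move: Yq; set q := daddv_pi Y X h => Yq.
have hE : h = p h + q by rewrite add.
split; rewrite {1}hE ?mulrDr ?mulrDl linearD [X in _ + X]p0 ?addr0.
- by apply: pid; apply: (subvP KX); rewrite memv_mul.
(* Write a = S(S(c)) and c = S(d) inside K. The Nakayama clause gives l(a q S(x)) = l(q S(x) c) =
   l(q S(d x)), which is 0 because d x is in X. *)
- apply/YP => x Xx; have [b Kb <-] := nhs_antipode_surj Ka.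
  have [c Kc <-] := nhs_antipode_surj Kb.
  have [d Kd <-] := nhs_antipode_surj Kc.
  rewrite -mulrA -lN -mulrA -antipodeM; apply: (YP q).1 => //.
  by apply: (subvP KX); rewrite memv_mul.
- by apply: pid; apply: (subvP XK); rewrite memv_mul.
apply/YP => x Xx; have [b Kb <-] := nhs_antipode_surj Ka.
rewrite -mulrA -antipodeM; apply: (YP q).1 => //.
by apply: (subvP XK); rewrite memv_mul.
Qed.

Lemma coset_subcoalgebra C : subcoalgebra (C * K)%VS.
Proof. by apply: subcoalgebra_prod; [apply: ssc_sub | apply: nhs_comul]. Qed.

Lemma coset_refl C : coset_equiv K C C.
Proof. by apply/subvP => x Cx; rewrite -[x]mulr1 memv_mul ?nhs_1. Qed.

Lemma coset_equivS C D : coset_equiv K C D -> (C * K <= D * K)%VS.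
Proof.
by move=> CD; apply: subv_trans (prodvSl _ CD) _; rewrite -prodvA prodv_id.
Qed.

Lemma coset_trans C D E : coset_equiv K C D -> coset_equiv K D E -> coset_equiv K C E.
Proof. by move=> CD /coset_equivS; apply: subv_trans. Qed.

Lemma simple_cap C X : subcoalgebra X -> ~~ (C <= X)%VS -> (C :&: X = 0)%VS.
Proof.
move=> sX nCX; have [] // := @ssc_simple _ _ C (C :&: X)%VS.
- by apply: subcoalgebra_cap => //; apply: ssc_sub.
- exact: capvSl.
by move=> E; case/negP: nCX; rewrite -E capvSr.
Qed.

(** If D is not inside C K, simplicity makes them disjoint, so l(D S(C K)) = 0. Moving S(K) = K to
    the other argument, l(D K S(C)) = 0, so D K and C are disjoint, against C <= D K. *)
Lemma coset_sym C D : coset_equiv K C D -> coset_equiv K D C.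
Proof.
have [ll l1 _ _ lN] := hl.
move=> CD; apply/negPn/negP => nDC.
have DC0 := simple_cap (coset_subcoalgebra C) nDC.
suff : (D * K :&: C = 0)%VS.
  by move=> /eqP; rewrite capvC (capv_idPl CD) (negPf (ssc_neq0 C)).
apply: (haar_orthogonal hl); [exact: coset_subcoalgebra | exact: ssc_sub |].
move=> x c DKx Cc; have [g gE] : exists g : 'Hom(H, k^o), g =1 (fun x => l (x * S c)).
  by apply: linear_hom; lin.
suff /subvP/(_ x DKx) : (D * K <= lker g)%VS by rewrite memv_ker gE => /eqP.
apply/prodvP => d a Dd Ka; rewrite memv_ker gE; have [b Kb <-] := nhs_antipode_surj Ka.
apply/eqP; rewrite -mulrA -antipodeM; apply: (haar_disjoint hl _ _ DC0) => //.
- exact: ssc_sub.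
- exact: coset_subcoalgebra.
by rewrite memv_mul.
Qed.

(** A simple subcoalgebra inside the intersection would be equivalent to both C and D. *)
Lemma coset_disjoint C D : ~~ coset_equiv K C D -> (C * K :&: D * K = 0)%VS.
Proof.
move=> nCD; apply/eqP; apply/negPn/negP => CDn0.
have [|E EX] := subcoalgebra_simple _ CDn0.
  by apply: subcoalgebra_cap; apply: coset_subcoalgebra.
case/negP: nCD; apply: (@coset_trans _ E).
  by apply: coset_sym; apply: subv_trans EX (capvSl _ _).
by apply: subv_trans EX (capvSr _ _).
Qed.

Lemma subcoalgebra_full X : subcoalgebra X -> (forall C, (C <= X)%VS) -> X = {:H}%VS.
Proof.
move=> sX CX; have [Y [sY XY0 XYH _]] := perp_exists hl sX.
have [Y0|Yn0] := eqVneq Y 0%VS; first by rewrite -XYH Y0 addv0.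
have [C CY] := subcoalgebra_simple sY Yn0.
case/negP: (ssc_neq0 C); rewrite -subv0 -XY0 subv_cap CY andbT.
exact: CX.
Qed.

Lemma subcoalgebra_sum I (r : seq I) (X : I -> {vspace H}) :
  (forall i, subcoalgebra (X i)) -> subcoalgebra (\sum_(i <- r) X i)%VS.
Proof.
move=> sX; elim/big_ind: _ => [|A B|i _]; [exact: subcoalgebra0 | exact: subcoalgebra_add |
  exact: sX].
Qed.

Lemma coset_sum (I : finType) (C_ : I -> simpleSubcoalgebra H) :
  coset_reps K C_ -> (\sum_i C_ i * K)%VS = {:H}%VS.
Proof.
move=> repC; apply: subcoalgebra_full => [|D].
  by apply: subcoalgebra_sum => i; apply: coset_subcoalgebra.
by have [i [DCi _]] := repC D; apply: subv_trans DCi (sumv_sup i _ _).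
Qed.

Lemma coset_reps_disjoint (I : finType) (C_ : I -> simpleSubcoalgebra H) i j :
  coset_reps K C_ -> i != j -> (C_ i * K :&: C_ j * K = 0)%VS.
Proof.
move=> repC ij; apply: coset_disjoint; apply/negP => Cij.
have [m [_ mu]] := repC (C_ i); case/eqP: ij.
by rewrite -(mu i (coset_refl _)) (mu j Cij).
Qed.

(** Orthogonality, unlike trivial intersection, passes from the single cosets to their sum. *)
Lemma simple_coset_disjoint D (s : seq (simpleSubcoalgebra H)) :
  ~~ has (fun C => coset_equiv K D C) s -> (D :&: (\sum_(C <- s) C * K) = 0)%VS.
Proof.
have [ll _ _ _ _] := hl; move=> nD; apply: (haar_orthogonal hl); first exact: ssc_sub.
  by apply: subcoalgebra_sum => C; apply: coset_subcoalgebra.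
move=> d + Dd; elim: s nD => [_|C s IHs] /=.
  by move=> x; rewrite big_nil memv0 => /eqP ->; rewrite linear0 mulr0 linear_zero.
rewrite negb_or => /andP[nDC nDs] z; rewrite big_cons => /memv_addP[x CKx [y Yy ->]].
rewrite linearD mulrDr /= -[_ * _]scale1r ll scale1r (IHs nDs y Yy) addr0.
apply: (haar_disjoint hl (ssc_sub D) (coset_subcoalgebra C)) => //.
by apply: simple_cap nDC; apply: coset_subcoalgebra.
Qed.

(** Add uncovered simple subcoalgebras one at a time; each strictly enlarges the sum of the cosets,
    whose dimension is bounded by that of H. *)
Lemma coset_reps_exist : exists (I : finType) (C_ : I -> simpleSubcoalgebra H), coset_reps K C_.
Proof.
pose P (s : seq (simpleSubcoalgebra H)) := pairwise (fun C D => ~~ coset_equiv K C D) s.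
have [s [Ps cov]] : exists s, P s /\ forall D, has (fun C => coset_equiv K D C) s.
  have [n] := ubnP (\dim {:H} - \dim (\sum_(C <- [::] : seq (simpleSubcoalgebra H)) C * K)%VS)%N.
  have : P [::] by [].
  elim: n [::] => // n IHn s Ps; rewrite ltnS => dn.
  have [|ncov] := classic (forall D, has (fun C => coset_equiv K D C) s).
    by exists s.
  have [D nD] : exists D, ~~ has (fun C => coset_equiv K D C) s.
    apply: NNPP => h; apply: ncov => D; apply/negPn/negP => nD; apply: h.
    by exists D.
  apply: (IHn (D :: s)); first by rewrite /P /= -/(P s) Ps andbT -all_predC in nD *.
  apply: leq_trans dn; rewrite big_cons.
  have DK0 := simple_coset_disjoint nD.
  have lt : (\dim (\sum_(C <- s) C * K) < \dim (D * K + \sum_(C <- s) C * K))%N.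
    rewrite ltn_neqAle dimvS ?addvSr // andbT; apply/negP => /eqP dE.
    have E : (\sum_(C <- s) C * K == D * K + \sum_(C <- s) C * K)%VS.
      by rewrite eqEdim addvSr dE leqnn.
    case/negP: (ssc_neq0 D); rewrite -subv0 -DK0 subv_cap subvv (eqP E).
    exact: subv_trans (coset_refl D) (addvSl _ _).
  by apply: ltn_sub2l => //; apply: leq_trans lt (dimvS (subvf _)).
exists 'I_(size s), (tnth (in_tuple s)) => D.
have [i lt_i Di] := has_nthP D (cov D).
exists (Ordinal lt_i); split=> [|j]; rewrite (tnth_nth D) //= => Dj.
have lt a b : (a < b)%N -> (b < size s)%N ->
    coset_equiv K D (nth D s a) -> coset_equiv K D (nth D s b) -> False.
  move=> ab bs Da Db; have := pairwiseP D Ps a b (ltn_trans ab bs) bs ab.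
  by case/negP; apply: coset_trans Db; apply: coset_sym.
by apply/val_inj; case: (ltngtP i j) => // ij; [case: (lt i j) | case: (lt j i)].
Qed.

End Cosets.

(** * Modules *)

Section Modules.
Variables (k : fieldType) (A : falgType k).
Implicit Types M N : fdModule A.

Definition equivariant M N (f : M -> N) := forall a v, f (fdm_act a v) = fdm_act a (f v).

Lemma fdm_act_bilin M : bilin (@fdm_act k A M).
Proof. by split=> ?; [apply: fdm_actl | apply: fdm_actr]. Qed.

Section Submodule.
Variables (M : fdModule A) (W : {vspace M}).
Hypothesis sW : submodule W.

Let act (a : A) (x : subvs_of W) := vsproj W (fdm_act a (vsval x)).

Fact submod_actl x : linear (act^~ x).
Proof. by move=> c a b; rewrite /act fdm_actl linearP. Qed.

Fact submod_actr a : linear (act a).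
Proof. by move=> c x y; rewrite /act linearP fdm_actr linearP. Qed.

Fact submod_act1 x : act 1 x = x.
Proof. by rewrite /act fdm_act1 vsvalK. Qed.

Fact submod_actM a b x : act (a * b) x = act a (act b x).
Proof. by rewrite /act vsprojK ?fdm_actM // sW ?subvsP. Qed.

Definition submod : fdModule A :=
  FdModule submod_actl submod_actr submod_act1 submod_actM.

End Submodule.

Lemma split_direct_summand M N (f : 'Hom(M, N)) (r : 'Hom(N, M)) :
  equivariant f -> equivariant r -> cancel f r -> direct_summand M N.
Proof.
move=> fA rA fK; have sW : submodule (lker r).
  by move=> a v; rewrite !memv_ker rA => /eqP ->; rewrite linear_zero //; apply: fdm_actr.
exists (submod sW).
have Wv v : v - f (r v) \in lker r by rewrite memv_ker linearB /= fK subrr.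
have [F FE] : exists F : 'Hom(N, dirsum M (submod sW)),
    F =1 (fun v => (r v, vsproj (lker r) (v - f (r v)))).
  apply: linear_hom => c x y; congr (_, _); rewrite linearP //= linearP opprD addrACA.
  by rewrite -scalerN -scalerDr linearP.
exists F; split=> [|a v]; last first.
  rewrite !FE /= (rA a v); congr (_, _); rewrite (fA a (r v)) vsprojK //; congr (vsproj _ _).
  by rewrite -!scaleN1r addrC -fdm_actr addrC.
exists (fun x => f x.1 + vsval x.2) => [v | [m w]].
  by rewrite FE /= vsprojK // addrC subrK.
have rw : r (vsval w) = 0 by apply/eqP; rewrite -memv_ker subvsP.
by rewrite FE /= linearD /= fK rw addr0 addrC addKr vsvalK.
Qed.

(** Complete reducibility phrased with equivariant projections, the form that averaging produces. *)
Definition splits N := forall U : {vspace N}, submodule U -> exists p : 'End(N),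
  [/\ equivariant p, forall v, p v \in U & forall v, v \in U -> p v = v].

Lemma limg_submodule M N (f : 'Hom(M, N)) : equivariant f -> submodule (limg f).
Proof.
move=> fA a _ /memv_imgP[v _ ->]; rewrite -fA; apply: memv_img; exact: memvf.
Qed.

Lemma lker_submodule M N (f : 'Hom(M, N)) : equivariant f -> submodule (lker f).
Proof.
move=> fA a v; rewrite !memv_ker fA => /eqP ->.
by rewrite linear_zero //; apply: fdm_actr.
Qed.

Lemma splits_direct_summand M N (f : 'Hom(M, N)) :
  splits N -> equivariant f -> lker f == 0%VS -> direct_summand M N.
Proof.
move=> spN fA f0; have [p [pA pU pid]] := spN _ (limg_submodule fA).
have fV v : f ((f^-1)%VF (p v)) = p v by apply: limg_lfunVK.
apply: (@split_direct_summand M N f (f^-1 \o p)%VF fA) => [a v | v].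
  have /lker0P finj := f0; apply: finj.
  by rewrite !comp_lfunE /= fA !fV pA.
by rewrite comp_lfunE /= pid ?lker0_lfunK // memv_img ?memvf.
Qed.

Lemma irreducible_hom M N (f : 'Hom(M, N)) :
  irreducible M -> equivariant f -> lker f == 0%VS \/ f =1 (fun=> 0).
Proof.
move=> [_ irrM] fA; have [->|E] := irrM _ (lker_submodule fA); first by left.
by right=> v; apply/eqP; rewrite -memv_ker E memvf.
Qed.

End Modules.

(** * Maps out of a tensor product over an algebra *)

Section TensorOverTheory.
Variables (k : fieldType) (B A : falgType k) (X : fdBimodule B A) (M : fdModule A).

Definition tov (x : X) (m : M) : tens_over X M := qproj (balancing X M) (tens x m).

Lemma tov_bilin : bilin tov.
Proof.
have [tl tr] := tens_bilin X M.
by split=> [m|x] c u v; rewrite /tov ?tl ?tr linearP.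
Qed.

Lemma tov_balanced x a m : tov (fdb_ract x a) m = tov x (fdm_act a m).
Proof.
apply/eqP; rewrite -subr_eq0 /tov -linearB qproj_eq0; exact: balancing_mem.
Qed.

Lemma tov_act b x m : fdm_act b (tov x m) = tov (fdb_lact b x) m.
Proof.
rewrite /= /tov tens_over_actE /tact tliftE //; exact: tact_bilin.
Qed.

Lemma tov_ext (U : vectType k) (f g : 'Hom(tens_over X M, U)) :
  (forall x m, f (tov x m) = g (tov x m)) -> f =1 g.
Proof.
move=> fg q; rewrite -[q]qprojK.
by apply: (@tensor_ext _ _ _ _ (f \o qproj (balancing X M)) (g \o qproj (balancing X M))).
Qed.

Lemma tov_lift (U : vectType k) (b : X -> M -> U) :
  bilin b -> (forall x a m, b (fdb_ract x a) m = b x (fdm_act a m)) ->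
  exists f : 'Hom(tens_over X M, U), forall x m, f (tov x m) = b x m.
Proof.
move=> bb bal; have [f fE] : exists f : 'Hom(tens_over X M, U), f =1 (fun q => tlift b (vsval q)).
  by apply: linear_hom => c u v; rewrite !linearP.
exists f => x m; rewrite fE -[RHS](tliftE _ _ bb) /tov.
apply/eqP; rewrite -subr_eq0 -linearB -memv0.
apply: (balancing_ind (f := tlift b) (Y := 0%VS)) (qprojD _ _) => y a n.
by rewrite linearB /= !tliftE // bal subrr mem0v.
Qed.

Lemma tov_ind (U : {vspace tens_over X M}) : (forall x m, tov x m \in U) -> forall q, q \in U.
Proof.
move=> tU q; rewrite -qproj_eq0.
have [f fE] : exists f : 'Hom(tens_over X M, quotv U), f =1 qproj U by apply: linear_hom;
  apply: linearP.
rewrite -fE (tov_ext (f := f) (g := 0%VF)) ?zero_lfunE // => x m.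
by rewrite zero_lfunE fE; apply/eqP; rewrite qproj_eq0.
Qed.

End TensorOverTheory.

(** * Maschke's theorem *)

Section Integral.
Variables (k : fieldType) (H : hopfType k) (L : H).
Local Notation S := (@antipode k H).
Hypothesis mulL : forall h, h * L = (counit h : k) *: L.
Hypothesis epsL : counit L = 1.
Hypothesis S_surj : forall h : H, exists g, S g = h.

(** Average a linear projection pi onto U to v |-> L_1 pi(S(L_2) v). *)
Lemma integral_splits (V : fdModule H) : splits V.
Proof.
move=> U sU; have ab := fdm_act_bilin V.
have [p pE] : exists p : 'End(V), p =1 (fun v => sw L (fun a b => fdm_act a (projv U (fdm_act (S
  b) v)))).
  by apply: linear_hom; lin.
exists p; split=> [h v | v | v Uv]; rewrite !pE.
(* [sw_integral_l] moves only elements of the form S(g) across L, hence the surjectivity of S. *)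
- have [g <-] := S_surj h; rewrite [RHS]sw_comp; last exact: fdm_actr.
  under [RHS]eq_sw do rewrite -fdm_actM.
  rewrite (sw_integral_l mulL g (F := fun a b => fdm_act a (projv U (fdm_act (S b) v))));
    last by multilin.
  by apply: eq_sw => a b; rewrite antipodeM fdm_actM.
- apply: rpred_sum => i _; apply: rpred_sum => j _; apply: rpredZ.
  by apply: sU; apply: memv_proj.
under eq_sw do rewrite projv_id ?sU // -fdm_actM.
rewrite (sw_antipoder L (f := fun z => fdm_act z v)); last exact: fdm_actl.
by rewrite epsL fdm_act1 scale1r.
Qed.

End Integral.

Section Bigdirsum.
Variables (k : fieldType) (A : falgType k) (V : fdModule A).
Variables (I : finType) (N : I -> fdModule A).
Variables (f : forall i, 'Hom(V, N i)) (g : forall i, 'Hom(N i, V)).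
Hypothesis fA : forall i, equivariant (f i).
Hypothesis fK : forall i, cancel (g i) (f i).
Hypothesis fg0 : forall i j x, i != j -> f i (g j x) = 0.
Hypothesis gf1 : forall v, \sum_i g i (f i v) = v.

(** Induction on the list under the iterated sum. For a partial list G F is only the partial sum of
    the g_i f_i, so the invariant records it instead of bijectivity. *)
Lemma bigdirsum_iso : fdm_iso V (bigdirsum N).
Proof.
pose P (r : seq I) (B : fdModule A) := exists (F : 'Hom(V, B)) (G : 'Hom(B, V)),
  [/\ equivariant F, cancel G F & forall v, G (F v) = \sum_(i <- r) g i (f i v)].
suff [F [G [FA GK FE]]] : P (index_enum I) (bigdirsum N).
  exists F; split=> //; exists G => // v.
  by rewrite FE.
rewrite /bigdirsum; elim: (index_enum I) (index_enum_uniq I) => [_|i r IHr].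
  exists 0, 0; rewrite big_nil; split=> [a v | x | v].
  - by rewrite !zero_lfunE.
  - by rewrite zero_lfunE; apply/rowP => -[].
  by rewrite big_nil zero_lfunE.
move=> /= /andP[ir ur]; rewrite big_cons; have := IHr ur.
move: (\big[_/_]_(j <- r) N j) => B [F [G [FA GK FE]]].
have fG x : f i (G x) = 0.
  rewrite -[x]GK FE linear_sum big1_seq //= => j /= jr.
  by apply: fg0; apply: contraNneq ir => ->.
have Fg x : F (g i x) = 0.
  have [F' F'E] : exists F' : B, F (g i x) = F' by exists (F (g i x)).
  rewrite F'E -[F']GK -F'E FE big1_seq ?linear0 // => j /= jr.
  by rewrite fg0 ?linear0 //; apply: contraNneq ir => <-.
have [F1 F1E] : exists F1 : 'Hom(V, dirsum (N i) B), F1 =1 (fun v => (f i v, F v)).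
  by apply: linear_hom => c x y; rewrite !linearP.
have [G1 G1E] : exists G1 : 'Hom(dirsum (N i) B, V), G1 =1 (fun x => g i x.1 + G x.2).
  apply: linear_hom => c x y; rewrite /= !linearP /=.
  by rewrite scalerDr addrACA.
exists F1, G1; split=> [a v | [x y] | v].
- by rewrite !F1E /= (fA i a v) (FA a v).
- rewrite G1E F1E /= !linearD /= (fK x) fG addr0; congr (_, _).
  by rewrite Fg add0r (GK y).
by rewrite big_cons F1E G1E /= (FE v).
Qed.

End Bigdirsum.

(** * Induced modules *)

Section Clifford.
Variables (k : closedFieldType) (H : hopfType k).
Local Notation S := (@antipode k H).
Local Notation eps := (@counit k H).
Implicit Types (X Y Z : {vspace H}).

Variable l : H -> k^o.
Hypothesis hl : haar l.
Hypothesis S_inj : forall h, S h = 0 -> h = 0.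
Variable K : normalHopfSubalgebra H.
Implicit Types C D E : simpleSubcoalgebra H.
Implicit Types M N : fdModule (nhs_alg K).

Definition ind_tens M (h : H) (m : M) : induced M := @tov k H (nhs_alg K) (alg_bimod K) M h m.

Lemma ind_tens_bilin M : bilin (@ind_tens M).
Proof. exact: (@tov_bilin k H (nhs_alg K) (alg_bimod K) M). Qed.

Lemma ind_tens_balanced M h (a : nhs_alg K) (m : M) :
  ind_tens (h * vsval a) m = ind_tens h (fdm_act a m).
Proof. exact: (@tov_balanced k H (nhs_alg K) (alg_bimod K)). Qed.

Lemma ind_tens_act M g h (m : M) :
  fdm_act g (ind_tens h m) = ind_tens (g * h) m.
Proof. exact: (@tov_act k H (nhs_alg K) (alg_bimod K)). Qed.

Lemma ind_ext M (U : vectType k) (f g : 'Hom(induced M, U)) :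
  (forall h m, f (ind_tens h m) = g (ind_tens h m)) -> f =1 g.
Proof. exact: (@tov_ext k H (nhs_alg K) (alg_bimod K)). Qed.

Lemma ind_lift M (U : vectType k) (b : H -> M -> U) :
  bilin b -> (forall h (a : nhs_alg K) m, b (h * vsval a) m = b h (fdm_act a m)) ->
  exists f : 'Hom(induced M, U), forall h m, f (ind_tens h m) = b h m.
Proof. exact: (@tov_lift k H (nhs_alg K) (alg_bimod K)). Qed.

Lemma ind_ind M (U : {vspace induced M}) :
  (forall h m, ind_tens h m \in U) -> forall q, q \in U.
Proof. exact: (@tov_ind k H (nhs_alg K) (alg_bimod K)). Qed.

(** Tensor with M the inclusion of C K in H and the K-bilinear projection back; since the inclusion
    is split, it stays injective after tensoring. *)
Lemma coset_conjugate_maps C M :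
  exists (f : 'Hom(induced M, conjugate C M)) (g : 'Hom(conjugate C M, induced M)),
  [/\ (forall (a : nhs_alg K) q, f (fdm_act (vsval a) q) = fdm_act a (f q)) /\
      (forall (a : nhs_alg K) q, g (fdm_act a q) = fdm_act (vsval a) (g q)),
      cancel g f,
      forall h m, h \in (C * K)%VS -> g (f (ind_tens h m)) = ind_tens h m,
      forall U : {vspace induced M},
        (forall h m, h \in (C * K)%VS -> ind_tens h m \in U) -> forall x, g x \in U &
      forall Z h m, subcoalgebra Z -> (C * K :&: Z = 0)%VS -> h \in Z -> f (ind_tens h m) = 0].
Proof.
have [p [pC pid p0 pK]] := bistable_projection hl S_inj (coset_subcoalgebra K C) (coset_bistable
  K C).
pose ct (x : subvs_of (C * K)%VS) (m : M) : conjugate C M := @tov k _ _ (coset_bimod K C) M x m.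
have ctb : bilin ct by apply: (@tov_bilin k _ _ (coset_bimod K C) M).
have [f fE] : exists f : 'Hom(induced M, conjugate C M),
    forall h m, f (ind_tens h m) = ct (vsproj (C * K)%VS (p h)) m.
  apply: ind_lift => [|h a m].
    by split=> [m|h] c x y; rewrite ?linearP ?ctb.1 ?ctb.2.
  rewrite -[RHS](@tov_balanced k _ _ (coset_bimod K C)) /=; congr (ct _ m).
  rewrite (pK _ _ (subvsP a)).2 vsprojK //.
have [g gE] : exists g : 'Hom(conjugate C M, induced M),
    forall x m, g (ct x m) = ind_tens (vsval x) m.
  have ib := ind_tens_bilin M.
  apply: (@tov_lift k _ _ (coset_bimod K C)) => [|x a m]; first by split=> ?; lin.
  rewrite -ind_tens_balanced /= vsprojK //.
  by rewrite (subvP (coset_rstable K C)) ?memv_mul ?subvsP.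
have ib := ind_tens_bilin M.
exists f, g; split; first split.
- move=> a q.
  have [f1 f1E] : exists f1 : 'Hom(induced M, conjugate C M), f1 =1 (fun q => f (fdm_act (vsval
    a) q)).
    by apply: linear_hom; apply: lin_lfun; apply: fdm_actr.
  have [f2 f2E] : exists f2 : 'Hom(induced M, conjugate C M), f2 =1 (fun q => fdm_act a (f q)).
    by apply: linear_hom => c x y; rewrite linearP fdm_actr.
  rewrite -f1E -f2E; apply: ind_ext => h m; rewrite f1E f2E ind_tens_act !fE.
  rewrite [RHS](@tov_act k _ _ (coset_bimod K C)) /=; congr (ct _ m).
  by rewrite (pK _ _ (subvsP a)).1 vsprojK.
- move=> a q.
  have [f1 f1E] : exists f1 : 'Hom(conjugate C M, induced M), f1 =1 (fun q => g (fdm_act a q)).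
    by apply: linear_hom; apply: lin_lfun; apply: fdm_actr.
  have [f2 f2E] : exists f2 : 'Hom(conjugate C M, induced M), f2 =1 (fun q => fdm_act (vsval a)
    (g q)).
    by apply: linear_hom => c x y; rewrite linearP fdm_actr.
  rewrite -f1E -f2E; apply: (@tov_ext k _ _ (coset_bimod K C)) => x m.
  rewrite f1E f2E (@tov_act k _ _ (coset_bimod K C)) !gE ind_tens_act /= vsprojK //.
  by rewrite (subvP (coset_lstable K C)) ?memv_mul ?subvsP.
- move=> q; have [f1 f1E] : exists f1 : 'End(conjugate C M), f1 =1 (fun q => f (g q)).
    by apply: linear_hom => c x y; rewrite !linearP.
  rewrite -f1E -[RHS](@id_lfunE _ (conjugate C M)).
  apply: (@tov_ext k _ _ (coset_bimod K C)) => x m.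
  by rewrite f1E id_lfunE gE fE pid ?subvsP // vsvalK.
- by move=> h m Ch; rewrite fE gE vsprojK // pid.
- move=> U CU x; rewrite memv_preim; move: x.
  apply: (@tov_ind k _ _ (coset_bimod K C)) => x m.
  by rewrite -memv_preim gE CU ?subvsP.
by move=> Z h m sZ CZ Zh; rewrite fE (p0 Z) // linear0 (linear_zero (f := fun x => ct x m)) //;
  apply: ctb.1.
Qed.

Lemma coset_decomposition (I : finType) (C_ : I -> simpleSubcoalgebra H) M :
  coset_reps K C_ -> exists (f : forall i, 'Hom(restrict K (induced M), conjugate (C_ i) M))
    (g : forall i, 'Hom(conjugate (C_ i) M, restrict K (induced M))),
  [/\ forall i, equivariant (f i), forall i, cancel (g i) (f i),
      forall i j x, i != j -> f i (g j x) = 0, forall v, \sum_i g i (f i v) = v &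
      forall i (U : {vspace induced M}),
        (forall h m, h \in (C_ i * K)%VS -> ind_tens h m \in U) -> forall x, g i x \in U].
Proof.
move=> repC.
have [f [g fgP]] : exists (f : forall i, 'Hom(restrict K (induced M), conjugate (C_ i) M))
    (g : forall i, 'Hom(conjugate (C_ i) M, restrict K (induced M))), forall i,
  [/\ equivariant (f i), cancel (g i) (f i),
      forall h m, h \in (C_ i * K)%VS -> g i (f i (ind_tens h m)) = ind_tens h m,
      forall U : {vspace induced M},
        (forall h m, h \in (C_ i * K)%VS -> ind_tens h m \in U) -> forall x, g i x \in U &
      forall Z h m, subcoalgebra Z -> (C_ i * K :&: Z = 0)%VS -> h \in Z -> f i (ind_tens h m) =
        0].
  have [f fP] := @fin_all_exists I _ _ (fun i => coset_conjugate_maps (C_ i) M).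
  have [g gP] := @fin_all_exists I _ _ fP.
  by exists f, g => i; case: (gP i) => -[].
have f0 i j h m : i != j -> h \in (C_ j * K)%VS -> f i (ind_tens h m) = 0.
  case: (fgP i) => _ _ _ _ fZ ij Cjh; apply: (fZ (C_ j * K)%VS) => //.
    exact: coset_subcoalgebra.
  exact: (coset_reps_disjoint hl S_inj).
exists f, g; split=> [i | i | i j x ij | v | i].
- by case: (fgP i).
- by case: (fgP i).
- apply/eqP; rewrite -memv_ker; case: (fgP j) => _ _ _ gU _; apply: gU => h m Cjh.
  by rewrite memv_ker (f0 i j).
have [F FE] : exists F : 'End(induced M), F =1 (fun v => \sum_i g i (f i v)).
  by apply: linear_hom; lin.
rewrite -FE -[RHS](@id_lfunE _ (induced M)); apply: ind_ext => h m; rewrite id_lfunE FE.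
have : h \in (\sum_i C_ i * K)%VS by rewrite (coset_sum hl repC) memvf.
case/memv_sumP=> hs hsC ->; have ib := ind_tens_bilin M.
rewrite (linear_big (f := fun h => ind_tens h m)); last by lin.
under eq_bigr do rewrite linear_sum linear_sum.
rewrite exchange_big; apply: eq_bigr => j _ /=.
rewrite (bigD1 j) //= big1 ?addr0 => [|i ij].
  by case: (fgP j) => _ _ gf _ _; rewrite gf ?hsC.
  by rewrite (f0 i j) ?linear0 ?hsC.
by case: (fgP i).
Qed.

Lemma induced_decomposition (I : finType) (C_ : I -> simpleSubcoalgebra H) M :
  coset_reps K C_ ->
  fdm_iso (restrict K (induced M)) (bigdirsum (fun i => conjugate (C_ i) M)).
Proof.
move=> repC; have [f [g [fA fK fg0 gf1 _]]] := coset_decomposition M repC.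
exact: (@bigdirsum_iso _ _ _ _ _ f g).
Qed.

(** The K-bilinear projection H -> K followed by K (x)_K M = M. The third clause is what makes the
    retraction respect submodules of M. *)
Lemma induced_retraction M : exists r : 'Hom(induced M, M),
  [/\ forall (a : nhs_alg K) q, r (fdm_act (vsval a) q) = fdm_act a (r q),
      forall m, r (ind_tens 1 m) = m,
      forall h m, exists a, r (ind_tens h m) = fdm_act a m &
      forall Z h m, subcoalgebra Z -> (K :&: Z = 0)%VS -> h \in Z -> r (ind_tens h m) = 0].
Proof.
have [p [pC pid p0 pK]] := bistable_projection hl S_inj (nhs_comul K) (nhs_bistable K).
have ab := fdm_act_bilin M.
have KM u v : u \in nhs_space K -> v \in nhs_space K -> u * v \in nhs_space K.
  by move=> Ku Kv; have := memv_mul Ku Kv; rewrite prodv_id.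
have val1 : vsproj K 1 = 1 :> nhs_alg K by apply/val_inj;
  rewrite /= vsprojK ?nhs_1 // -[RHS]/(vsval (1 : nhs_alg K)) nhs_val1.
have [r rE] : exists r : 'Hom(induced M, M),
    forall h m, r (ind_tens h m) = fdm_act (vsproj K (p h) : nhs_alg K) m.
  apply: ind_lift => [|h a m].
    by split=> [m|h] c x y; rewrite ?linearP ?ab.1 ?ab.2.
  rewrite -fdm_actM; congr (fdm_act _ m); apply/val_inj => /=.
  by rewrite (pK _ _ (subvsP a)).2 !vsprojK ?KM ?subvsP.
exists r; split.
- move=> a q.
  have [f1 f1E] : exists f1 : 'Hom(induced M, M), f1 =1 (fun q => r (fdm_act (vsval a) q)).
    by apply: linear_hom; apply: lin_lfun; apply: fdm_actr.
  have [f2 f2E] : exists f2 : 'Hom(induced M, M), f2 =1 (fun q => fdm_act a (r q)).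
    by apply: linear_hom => c x y; rewrite linearP fdm_actr.
  rewrite -f1E -f2E; apply: ind_ext => h m; rewrite f1E f2E ind_tens_act !rE.
  rewrite -fdm_actM; congr (fdm_act _ m); apply/val_inj => /=.
  by rewrite (pK _ _ (subvsP a)).1 !vsprojK ?KM ?subvsP.
- by move=> m; rewrite rE pid ?nhs_1 // val1 fdm_act1.
- by move=> h m; exists (vsproj K (p h)); rewrite rE.
by move=> Z h m sZ KZ Zh; rewrite rE (p0 Z) // linear0 (linear_zero (ab.1 m)).
Qed.

End Clifford.

(** * The irreducibility criterion *)

Section Irreducibility.
Variables (k : closedFieldType) (H : hopfType k).
Local Notation S := (@antipode k H).
Local Notation eps := (@counit k H).

Variable l : H -> k^o.
Hypothesis hl : haar l.
Hypothesis S_inj : forall h, S h = 0 -> h = 0.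
Hypothesis splitsH : forall V : fdModule H, splits V.
Variable K : normalHopfSubalgebra H.
Implicit Types C D E : simpleSubcoalgebra H.
Implicit Types M N : fdModule (nhs_alg K).

Lemma ind_tens_val M (a : nhs_alg K) (m : M) :
  ind_tens (vsval a) m = ind_tens 1 (fdm_act a m).
Proof. by rewrite -ind_tens_balanced mul1r. Qed.

Lemma ind_tens_act1 M (a : nhs_alg K) (m : M) :
  fdm_act (vsval a) (ind_tens 1 m) = ind_tens 1 (fdm_act a m).
Proof. by rewrite ind_tens_act mulr1 ind_tens_val. Qed.

Lemma ind_tens1 M h (m : M) : ind_tens h m = fdm_act h (ind_tens 1 m).
Proof. by rewrite ind_tens_act mulr1. Qed.

Lemma induced_submod M (U : {vspace M}) (sU : submodule U) :
  exists j : 'Hom(induced (submod sU), induced M), equivariant j /\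
    forall h u, j (ind_tens h u) = ind_tens h (vsval u).
Proof.
have ib := ind_tens_bilin M.
have [j jE] : exists j : 'Hom(induced (submod sU), induced M),
    forall h u, j (ind_tens h u) = ind_tens h (vsval u).
  apply: ind_lift => [|h a u].
    by split=> [u|h] c x y; rewrite ?linearP ?ib.1 ?ib.2.
  by rewrite ind_tens_balanced /= vsprojK // sU ?subvsP.
exists j; split=> // h q.
have [f1 f1E] : exists f1 : 'Hom(induced (submod sU), induced M), f1 =1 (fun q => j (fdm_act h
  q)).
  by apply: linear_hom; apply: lin_lfun; apply: fdm_actr.
have [f2 f2E] : exists f2 : 'Hom(induced (submod sU), induced M), f2 =1 (fun q => fdm_act h (j
  q)).
  by apply: linear_hom => c x y; rewrite linearP fdm_actr.
rewrite -f1E -f2E; apply: ind_ext => g u.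
by rewrite f1E f2E ind_tens_act !jE ind_tens_act.
Qed.

Lemma retraction_submod M (U : {vspace M}) (sU : submodule U)
    (j : 'Hom(induced (submod sU), induced M)) (r : 'Hom(induced M, M)) q :
  (forall h u, j (ind_tens h u) = ind_tens h (vsval u)) ->
  (forall h m, exists a, r (ind_tens h m) = fdm_act a m) -> r (j q) \in U.
Proof.
move=> jE rE; rewrite memv_preim memv_preim; move: q; apply: ind_ind => h u.
by rewrite -!memv_preim jE; have [a ->] := rE h (vsval u); rewrite sU ?subvsP.
Qed.

(* Retract N onto U through H (x) N -> H (x) U -> U, where the first map is an
   H-linear projection. *)
Lemma nhs_splits N : splits N.
Proof.
move=> U sU; have [j [jA jE]] := induced_submod sU.
have [r [rA r1 rE _]] := induced_retraction hl S_inj N.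
have [p [pA pj pid]] := splitsH (limg_submodule jA).
have ib := ind_tens_bilin N.
have [q qE] : exists q : 'End(N), q =1 (fun n => r (p (ind_tens 1 n))).
  by apply: linear_hom; lin.
exists q; split=> [a v | v | v Uv]; rewrite !qE.
- by rewrite -ind_tens_act1 pA rA.
- by have /memv_imgP[x _ ->] := pj (ind_tens 1 v); apply: retraction_submod.
rewrite pid ?r1 //; apply/memv_imgP; exists (ind_tens 1 (vsproj U v : submod sU));
  first exact: memvf.
by rewrite jE vsprojK.
Qed.

Lemma coset_nhs_disjoint C : ~ (C <= K)%VS -> (K :&: C * K = 0)%VS.
Proof.
move=> nCK; apply/eqP/negPn/negP => n0.
have [|E EX] := subcoalgebra_simple _ n0.
  by apply: subcoalgebra_cap; [apply: nhs_comul | apply: coset_subcoalgebra].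
apply: nCK; have EC : coset_equiv K E C by apply: subv_trans EX (capvSr _ _).
apply: subv_trans (coset_sym hl S_inj EC) _; apply: prodv_sub => //.
by apply: subv_trans EX (capvSl _ _).
Qed.

Lemma vspace_neq0_ex (V : vectType k) : {:V}%VS != 0%VS -> exists v : V, v != 0.
Proof. by move=> V0; exists (vpick {:V}); rewrite vpick0. Qed.

(** Let p be an H-projection onto a submodule U. On 1 (x) M its component in a coset outside K is a
    K-map from the irreducible M, so it is zero or exhibits M as a summand, which is excluded. Hence
    p is id (x) t for a K-endomorphism t of M, and the image of t, which is 0 or M, decides U. *)
Lemma irreducible_induced M : irreducible M ->
  (forall C, ~ (C <= K)%VS -> ~ direct_summand M (conjugate C M)) -> irreducible (induced M).
Proof.
move=> irrM nsum; have [M0 subM] := irrM; have ib := ind_tens_bilin M.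
have [r [rA r1 rE _]] := induced_retraction hl S_inj M.
split=> [|U sU].
  have [m m0] := vspace_neq0_ex M0; apply: contra m0 => /eqP V0.
  rewrite -(r1 m); have : ind_tens 1 m \in {:induced M}%VS by rewrite memvf.
  by rewrite V0 memv0 => /eqP ->; rewrite linear0.
have [p [pA pU pid]] := splitsH sU.
have [I [C_ repC]] := coset_reps_exist hl S_inj K.
have [f [g [fA fK fg0 gf1 gU]]] := coset_decomposition hl S_inj M repC.
have [e eE] : exists e : 'Hom(M, induced M), e =1 (fun m => ind_tens 1 m).
  by apply: linear_hom; lin.
have pW m : p (ind_tens 1 m) \in limg e.
  rewrite -[p _]gf1; apply: rpred_sum => i _.
  have [CK|/negP nCK] := boolP (C_ i <= K)%VS.
    apply: gU => h n CKh; have Kh : h \in nhs_space K.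
      by apply: (subvP _ h CKh); apply: prodv_sub.
    apply/memv_imgP; exists (fdm_act (vsproj K h : nhs_alg K) n); rewrite ?memvf //.
    by rewrite eE -ind_tens_val vsprojK.
  have [q qE] : exists q : 'Hom(M, conjugate (C_ i) M), q =1 (fun m => f i (p (ind_tens 1 m))).
    by apply: linear_hom => c x y; rewrite ib.2 !linearP.
  have qA : equivariant q by move=> a v; rewrite !qE -ind_tens_act1 pA fA.
  have [q0|q0] := irreducible_hom irrM qA; last by rewrite -qE q0 linear0 mem0v.
  by case: (nsum _ nCK); apply: splits_direct_summand qA q0; apply: nhs_splits.
have [t tE] : exists t : 'End(M), t =1 (fun m => r (p (ind_tens 1 m))).
  by apply: linear_hom => c x y; rewrite ib.2 !linearP.
have pt m : p (ind_tens 1 m) = ind_tens 1 (t m).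
  by have /memv_imgP[n _ E] := pW m; rewrite tE E eE r1.
have tA : equivariant t by move=> a m; rewrite !tE -ind_tens_act1 pA rA.
have phm h m : p (ind_tens h m) = ind_tens h (t m) by rewrite ind_tens1 pA pt -ind_tens1.
have [t0|t1] := subM _ (limg_submodule tA); [left | right].
  apply/eqP; rewrite -subv0; apply/subvP => v Uv; rewrite -(pid v Uv).
  rewrite memv_preim; move: v {Uv}; apply: ind_ind => h m; rewrite -memv_preim phm.
  have : t m \in limg t by rewrite memv_img ?memvf.
  by rewrite t0 memv0 => /eqP ->; rewrite (linear_zero (ib.2 h)) mem0v.
apply/eqP; rewrite eqEsubv subvf; apply/subvP => v _; move: v; apply: ind_ind => h m.
have : m \in limg t by rewrite t1 memvf.
by case/memv_imgP=> n _ ->; rewrite -phm.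
Qed.

(** A submodule of M induces one of H (x)_K M, and the retraction recovers it. An embedding of M
    into a conjugate outside K would extend to an H-endomorphism of the induced module, a scalar by
    Schur's lemma; the retraction shows the scalar to be 0. *)
Lemma induced_irreducible M : irreducible (induced M) -> irreducible M /\
  (forall C, ~ (C <= K)%VS -> ~ direct_summand M (conjugate C M)).
Proof.
move=> [V0 subV]; have ib := ind_tens_bilin M.
have [r [rA r1 rE r0]] := induced_retraction hl S_inj M.
have M0 : {:M}%VS != 0%VS.
  apply: contra V0 => /eqP M0; rewrite -subv0; apply/subvP => v _; move: v.
  apply: ind_ind => h m; have : m \in {:M}%VS by rewrite memvf.
  by rewrite M0 memv0 => /eqP ->; rewrite (linear_zero (ib.2 h)) mem0v.
have [m0 m0n0] := vspace_neq0_ex M0.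
split.
  split=> // U sU; have [j [jA jE]] := induced_submod sU.
  have [j0|j1] := subV _ (limg_submodule jA); [left | right].
    apply/eqP; rewrite -subv0; apply/subvP => u Uu.
    have : j (ind_tens 1 (vsproj U u : submod sU)) \in limg j by rewrite memv_img ?memvf.
    by rewrite j0 jE vsprojK // !memv0 => /eqP E; rewrite -(r1 u) E linear0.
  apply/eqP; rewrite eqEsubv subvf; apply/subvP => m _; rewrite -(r1 m).
  have : ind_tens 1 m \in limg j by rewrite j1 memvf.
  by case/memv_imgP=> q _ ->; apply: retraction_submod.
move=> C nCK [P [F [[G FK GK] FA]]].
have [f [g [[fA gA] fK _ gU _]]] := coset_conjugate_maps hl S_inj C M.
have Gl : linear G.
  move=> c x y; apply: (can_inj FK); rewrite GK.
  by transitivity (c *: F (G x) + F (G y)); [rewrite !GK | symmetry; apply: linearP].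
(* [G] is the inverse of the isomorphism [F], so [phi] embeds M into the C K component of the
   induced module. *)
pose phi m := g (G (m, 0)).
have phil : linear phi.
  move=> c x y; rewrite /phi -linearP -Gl; congr (g (G _)); congr (_, _).
  by rewrite -[RHS]/(c *: (0 : P) + 0) scaler0 addr0.
have phiA (a : nhs_alg K) m : phi (fdm_act a m) = fdm_act (vsval a) (phi m).
  rewrite /phi -gA; congr (g _); apply: (can_inj FK); rewrite FA !GK /=.
  by rewrite (linear_zero (fdm_actr _)).
have [Phi PhiE] : exists Phi : 'End(induced M), forall h m, Phi (ind_tens h m) = fdm_act h (phi
  m).
  apply: ind_lift => [|h a m]; last by rewrite phiA fdm_actM.
  by split=> [m|h] c x y; rewrite ?fdm_actl ?phil ?fdm_actr.
have [x [c [_ x0 Phix]]] := @closed_eigenvector k _ {:induced M}%VS Phi (linearP Phi) V0 (fun _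
  _ => memvf _).
have PhiA h v : Phi (fdm_act h v) = fdm_act h (Phi v).
  have [f1 f1E] : exists f1 : 'End(induced M), f1 =1 (fun q => Phi (fdm_act h q)).
    by apply: linear_hom; apply: lin_lfun; apply: fdm_actr.
  have [f2 f2E] : exists f2 : 'End(induced M), f2 =1 (fun q => fdm_act h (Phi q)).
    by apply: linear_hom => d y z; rewrite linearP fdm_actr.
  rewrite -f1E -f2E; apply: ind_ext => h' m.
  by rewrite f1E f2E ind_tens_act !PhiE fdm_actM.
(* The c-eigenspace of [Phi] is a nonzero submodule, hence everything; k being algebraically closed
   supplied c. *)
have scal v : Phi v = c *: v.
  have sE : submodule (lker (Phi - c *: \1)%VF).
    move=> h w; rewrite !memv_ker !lfun_simp /= !subr_eq0 PhiA => /eqP ->.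
    by rewrite (linear_scale _ _ (fdm_actr h)).
  have xE : x \in lker (Phi - c *: \1)%VF by rewrite memv_ker !lfun_simp /= Phix subrr.
  have [E0|E1] := subV _ sE; first by move: xE; rewrite E0 memv0 (negPf x0).
  have : v \in lker (Phi - c *: \1)%VF by rewrite E1 memvf.
  by rewrite memv_ker !lfun_simp /= subr_eq0 => /eqP.
have phiE : phi m0 = c *: ind_tens 1 m0 by rewrite -scal PhiE fdm_act1.
(* The retraction kills the C K component, while it sends [phi m0] = c (1 (x) m0) to c m0. *)
have : r (phi m0) = 0.
  apply/eqP; rewrite -memv_ker; apply: gU => h m CKh; rewrite memv_ker.
  by rewrite (r0 _ _ _ (coset_subcoalgebra K C) (coset_nhs_disjoint nCK)).
rewrite phiE linearZ /= r1 => /eqP; rewrite scaler_eq0 (negPf m0n0) orbF => /eqP c0.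
move: phiE; rewrite c0 scale0r => /(congr1 f); rewrite fK linear0 => /(congr1 F).
by rewrite GK linear0 => -[] E; case/eqP: m0n0.
Qed.

End Irreducibility.

(** The existence of a system of representatives accompanies the isomorphism so that (1) is not
    vacuous. *)
Theorem proposition69 (k : closedFieldType) (char0 : [pchar k] =i pred0)
    (H : hopfType k) (ssH : semisimple_algebra H)
    (K : normalHopfSubalgebra H) (M : fdModule (nhs_alg K)) :
  ((exists (I : finType) (C_ : I -> simpleSubcoalgebra H), coset_reps K C_) /\
   (forall (I : finType) (C_ : I -> simpleSubcoalgebra H), coset_reps K C_ ->
      fdm_iso (restrict K (induced M)) (bigdirsum (fun i => conjugate (C_ i) M))))
  /\
  (irreducible (induced M) <->
   irreducible M /\
   (forall C : simpleSubcoalgebra H, ~ (C <= K)%VS ->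
      ~ direct_summand M (conjugate C M))).
Proof.
have [l hl] := haar_exists char0 ssH.
have [L [mulL Lmul epsL]] := semisimple_integral ssH.
have S_inj := antipode_inj mulL epsL.
have splitsH := integral_splits mulL epsL (antipode_surj mulL epsL).
split; [split | split].
- exact: (coset_reps_exist hl S_inj).
- by move=> I C_; apply: (induced_decomposition hl S_inj).
- exact: (induced_irreducible hl S_inj).
by case=> irrM nsum; apply: (irreducible_induced hl S_inj splitsH).
Qed.
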